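(* Let $K_{\mathrm{FT\text{-}cln}}$ be the class of all fully-transpositional clones $C$ with $|\mathrm{Dom}(C)|\notin\{1,2,6\}$, and let $R=\{(\mathrm{Alg}(C),\mathrm{Act}(C)) : C\in K_{\mathrm{FT\text{-}cln}}\}$. Then $\{\mathrm{Act}(C):C\in K_{\mathrm{FT\text{-}cln}}\}$ is first order strongly interpretable (FS-interpretable) in $\{\mathrm{Alg}(C):C\in K_{\mathrm{FT\text{-}cln}}\}$ relative to $R$.
   Context: A clone on a nonempty set $A=\mathrm{Dom}(C)$ is a set $C\subseteq\bigcup_{n\geq1}A^{A^n}$ containing all projections $p^A_{n,i}(x_1,\dots,x_n)=x_i$ and closed under composition: if $f\in C\cap A^{A^n}$ and $g_1,\dots,g_n\in C\cap A^{A^k}$ then $\vec x\mapsto f(g_1(\vec x),\dots,g_n(\vec x))$ is in $C$. $C$ is fully-transpositional if every transposition of $A$ (permutation moving exactly two elements) belongs to $C$. Write $\mathrm{Fnc}_n(C)=C\cap A^{A^n}$. $\mathrm{Cmp}^C_{n,k}$ is the $(n+2)$-place relation of all $(f,g_1,\dots,g_n,h)$ with $f\in\mathrm{Fnc}_n(C)$, $g_i\in\mathrm{Fnc}_k(C)$ and $h=f(g_1,\dots,g_n)$ pointwise; $\mathrm{App}^C_n$ is the $(n+2)$-place relation of all $(f,a_1,\dots,a_n,b)$ with $f\in\mathrm{Fnc}_n(C)$, $a_i,b\in A$, $f(a_1,\dots,a_n)=b$. $\mathrm{Alg}(C)=\langle C,\{\mathrm{Cmp}^C_{n,k}\}_{n,k\geq1}\rangle$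 and $\mathrm{Act}(C)=\langle C\cup A,\{\mathrm{App}^C_n\}_{n\geq1}\rangle$. Formulas are first order. For a structure $M$ and formula $\phi(\bar x)$ with $|\bar x|=n$, $\phi[M^n]=\{\bar a\in|M|^n:M\models\phi[\bar a]\}$. Let $K,K^*$ be classes of structures in relational languages $\mathcal L,\mathcal L^*$ and $R\subseteq K\times K^*$ with $|M|\subseteq|M^*|$ for $(M,M^* )\in R$. $K^*$ is FS-interpretable in $K$ relative to $R$ if there are $n\geq1$, an $\mathcal L$-formula $\phi_U(\bar x)$ ($|\bar x|=n$), for each $m$-place relation symbol $P$ of $\mathcal L^*$ (including equality) an $\mathcal L$-formula $\phi_P(\bar x^1,\dots,\bar x^m)$ ($|\bar x^j|=n$), an $\mathcal L$-formula $\phi_{\mathrm{Imap}}(\bar x,x)$ and an $\mathcal L^*$-formula $\phi^*_{\mathrm{Imap}}(\bar x,x)$ such that for every $(M,M^* )\in R$, $\tau=\phi^*_{\mathrm{Imap}}[(M^* )^{n+1}]$ is a function from $\phi_U[M^n]$ onto $|M^*|$ with $(\tau(\bar a^1),\dots,\tau(\bar a^m))\in P^{M^*}$ iff $M\models\phi_P[\bar a^1,\dots,\bar a^m]$ for all $P$ and all $\bar a^j\in\phi_U[M^n]$, and $\phi_{\mathrm{Imap}}[M^{n+1}]=\{(\bar a,b)\in\tau:b\in|M|\}$. *)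

(* Defs.v *)
From mathcomp Require Import all_boot.
From mathcomp Require Import all_classical.

Set Implicit Arguments.
Unset Strict Implicit.
Unset Printing Implicit Defensive.

Local Open Scope card_scope.
Local Open Scope classical_set_scope.

(** * First-order logic over relational languages *)

Record language := Language {
  symbol :> Type;
  arity : symbol -> nat }.

(** The universe of a structure is a subset of an ambient type [U], so that
    [|M| ⊆ |M'|] makes literal sense for two structures (possibly in different
    languages) living in the same [U]. *)
Record structure (L : language) (U : Type) := Structure {
  univ : set U;
  interp : forall P : L, set ('I_(arity P) -> U);
  interp_univ : forall (P : L) (v : 'I_(arity P) -> U),
    interp v -> forall i, univ (v i) }.

(** [formula L V]: first-order formulas with equality whose free variables are
    among the elements of [V].  Under a quantifier, [None] is the bound variable
    and [Some x] is the variable [x] of the enclosing context. *)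
Inductive formula (L : language) (V : Type) : Type :=
| fEq of V & V
| fRel (P : L) of ('I_(arity P) -> V)
| fNot of formula L V
| fAnd of formula L V & formula L V
| fOr of formula L V & formula L V
| fImp of formula L V & formula L V
| fAll of formula L (option V)
| fEx of formula L (option V).

(** The assignment [(a, b)] for the list of variables [(xbar, x)]. *)
Definition assign (V U : Type) (a : V -> U) (b : U) : option V -> U :=
  fun x => if x is Some y then a y else b.

Fixpoint sat (L : language) (U : Type) (M : structure L U)
    (V : Type) (phi : formula L V) : (V -> U) -> Prop :=
  match phi with
  | fEq x y => fun e => e x = e y
  | fRel P v => fun e => interp M (P := P) (fun i => e (v i))
  | fNot p => fun e => ~ sat M p e
  | fAnd p q => fun e => sat M p e /\ sat M q e
  | fOr p q => fun e => sat M p e \/ sat M q e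
  | fImp p q => fun e => sat M p e -> sat M q e
  | fAll p => fun e => forall b, univ M b -> sat M p (assign e b)
  | fEx p => fun e => exists2 b, univ M b & sat M p (assign e b)
  end.

(** [phi[M^V]] *)
Definition extension (L : language) (U : Type) (M : structure L U)
    (V : Type) (phi : formula L V) : set (V -> U) :=
  [set e | (forall x, univ M (e x)) /\ sat M phi e].

(** * FS-interpretability *)

Definition structure_class (L : language) :=
  forall U : Type, structure L U -> Prop.

Definition structure_relation (L L' : language) :=
  forall U : Type, structure L U -> structure L' U -> Prop.

(** The graph [tau], a set of tuples [(a, b)], is a function from [X] onto [Y]. *)
Definition is_function_onto (V U : Type) (tau : set (option V -> U))
    (X : set (V -> U)) (Y : set U) : Prop :=
  [/\ forall a b, tau (assign a b) -> X a /\ Y b,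
      forall a, X a -> exists! b, tau (assign a b)
    & forall b, Y b -> exists a, tau (assign a b)].

(** The conditions on one pair [(M, M')].  The variables [xbar^1,...,xbar^m] of
    [phiP P], each [xbar^j] being of length [n], are indexed by pairs [(j, i)]. *)
Definition FS_interprets (L L' : language) (n : nat)
    (phiU : formula L 'I_n)
    (phiP : forall P : L', formula L ('I_(arity P) * 'I_n))
    (phiEq : formula L ('I_2 * 'I_n))
    (phiImap : formula L (option 'I_n))
    (phiImap' : formula L' (option 'I_n))
    (U : Type) (M : structure L U) (M' : structure L' U) : Prop :=
  let tau := extension M' phiImap' in
  [/\ is_function_onto tau (extension M phiU) (univ M'),
      forall (P : L') (a : 'I_(arity P) -> 'I_n -> U) (b : 'I_(arity P) -> U),
        (forall j, extension M phiU (a j)) ->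
        (forall j, tau (assign (a j) (b j))) ->
        interp M' b <-> sat M (phiP P) (fun ji => a ji.1 ji.2),
      forall (a : 'I_2 -> 'I_n -> U) (b : 'I_2 -> U),
        (forall j, extension M phiU (a j)) ->
        (forall j, tau (assign (a j) (b j))) ->
        b ord0 = b ord_max <-> sat M phiEq (fun ji => a ji.1 ji.2)
    & extension M phiImap = [set e | tau e /\ univ M (e None)]].

Definition FS_interpretable (L L' : language)
    (K' : structure_class L') (K : structure_class L)
    (R : structure_relation L L') : Prop :=
  (forall (U : Type) (M : structure L U) (M' : structure L' U),
     R U M M' -> [/\ K U M, K' U M' & univ M `<=` univ M']) /\
  exists (n : nat)
    (phiU : formula L 'I_n)
    (phiP : forall P : L', formula L ('I_(arity P) * 'I_n))
    (phiEq : formula L ('I_2 * 'I_n))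
    (phiImap : formula L (option 'I_n))
    (phiImap' : formula L' (option 'I_n)),
    (1 <= n)%N /\
    forall (U : Type) (M : structure L U) (M' : structure L' U),
      R U M M' -> FS_interprets phiU phiP phiEq phiImap phiImap' M M'.

(** * Clones *)

(** Only positive arities occur; throughout, an index [n : nat] stands for the
    arity [n.+1].  An operation carries its arity, so operations of different
    arities are distinct. *)
Definition op (A : Type) (n : nat) : Type := ('I_n.+1 -> A) -> A.

Definition operation (A : Type) : Type := {n : nat & op A n}.

Definition Op (A : Type) (n : nat) (f : op A n) : operation A := existT _ n f.

Definition proj (A : Type) (n : nat) (i : 'I_n.+1) : op A n := fun x => x i.

Definition comp (A : Type) (n k : nat) (f : op A n) (g : 'I_n.+1 -> op A k) :
  op A k := fun x => f (fun i => g i x).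

Record clone (A : Type) := Clone {
  clone_set : set (operation A);
  clone_dom : [set: A] !=set0;
  clone_proj : forall (n : nat) (i : 'I_n.+1), clone_set (Op (@proj A n i));
  clone_comp : forall (n k : nat) (f : op A n) (g : 'I_n.+1 -> op A k),
    clone_set (Op f) -> (forall i, clone_set (Op (g i))) ->
    clone_set (Op (comp f g)) }.

Definition Fnc (A : Type) (n : nat) (C : clone A) : set (op A n) :=
  [set f | clone_set C (Op f)].

Definition is_transposition (A : Type) (s : A -> A) : Prop :=
  bijective s /\
  exists a b : A, a <> b /\ forall x, s x <> x <-> x = a \/ x = b.

Definition fully_transpositional (A : Type) (C : clone A) : Prop :=
  forall s : A -> A, is_transposition s ->
    Fnc C (fun x : 'I_1 -> A => s (x ord0)).

Definition K_FTcln (A : Type) (C : clone A) : Prop :=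
  [/\ fully_transpositional C,
      [set: A] #!= `I_1, [set: A] #!= `I_2 & [set: A] #!= `I_6].

(** * The structures Alg(C) and Act(C) *)

(** Both structures live in the disjoint union [operation A + A]. *)
Definition ambient (A : Type) : Type := (operation A + A)%type.

(** [Cmp n k] and [App n] have [n.+1 + 2] places: a first one, [n.+1] middle ones
    and a last one. *)
Definition fst_place (n : nat) : 'I_n.+3 := ord0.
Definition mid_place (n : nat) (i : 'I_n.+1) : 'I_n.+3 :=
  lift ord0 (lift ord_max i).
Definition lst_place (n : nat) : 'I_n.+3 := ord_max.

Inductive Alg_symbol := Cmp (n k : nat).

Definition L_Alg : language :=
  Language (fun s : Alg_symbol => let: Cmp n _ := s in n.+3).

Inductive Act_symbol := App (n : nat).

Definition L_Act : language :=
  Language (fun s : Act_symbol => let: App n := s in n.+3).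

Definition Cmp_rel (A : Type) (C : clone A) (n k : nat) :
    set ('I_n.+3 -> ambient A) :=
  [set v | exists (f : op A n) (g : 'I_n.+1 -> op A k) (h : op A k),
    [/\ v (fst_place n) = inl (Op f),
        forall i, v (mid_place i) = inl (Op (g i)) &
        v (lst_place n) = inl (Op h)] /\
    [/\ Fnc C f, forall i, Fnc C (g i) & h = comp f g]].

Definition App_rel (A : Type) (C : clone A) (n : nat) :
    set ('I_n.+3 -> ambient A) :=
  [set v | exists (f : op A n) (a : 'I_n.+1 -> A) (b : A),
    [/\ v (fst_place n) = inl (Op f),
        forall i, v (mid_place i) = inr (a i) &
        v (lst_place n) = inr b] /\
    (Fnc C f /\ f a = b)].

Definition Alg_univ (A : Type) (C : clone A) : set (ambient A) :=
  [set u | if u is inl f then clone_set C f else False].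

Definition Act_univ (A : Type) (C : clone A) : set (ambient A) :=
  [set u | if u is inl f then clone_set C f else True].

Definition Alg_interp (A : Type) (C : clone A) (P : L_Alg) :
    set ('I_(arity P) -> ambient A) :=
  match P return set ('I_(@arity L_Alg P) -> ambient A) with
  | Cmp n k => @Cmp_rel A C n k
  end.

Definition Act_interp (A : Type) (C : clone A) (P : L_Act) :
    set ('I_(arity P) -> ambient A) :=
  match P return set ('I_(@arity L_Act P) -> ambient A) with
  | App n => @App_rel A C n
  end.

Lemma placeP (n : nat) (Q : 'I_n.+3 -> Prop) :
  Q (fst_place n) -> (forall i, Q (mid_place i)) -> Q (lst_place n) ->
  forall j, Q j.
Proof.
move=> Q0 Qm Ql j; case: (unliftP ord0 j) => [j' ->|-> //].
case: (unliftP ord_max j') => [i ->|->]; first exact: Qm.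
by have -> : lift ord0 ord_max = lst_place n by apply/val_inj.
Qed.

Lemma Alg_interp_univ (A : Type) (C : clone A) (P : L_Alg)
    (v : 'I_(arity P) -> ambient A) :
  Alg_interp C v -> forall i, Alg_univ C (v i).
Proof.
case: P v => n k v [f [g [h [[vf vg vh] [Cf Cg hE]]]]].
apply: placeP => [|i|]; rewrite ?vf ?vg ?vh //=; first exact: Cg.
by rewrite hE; apply: clone_comp.
Qed.

Lemma Act_interp_univ (A : Type) (C : clone A) (P : L_Act)
    (v : 'I_(arity P) -> ambient A) :
  Act_interp C v -> forall i, Act_univ C (v i).
Proof.
case: P v => n v [f [a [b [[vf va vb] [Cf _]]]]].
by apply: placeP => [|i|]; rewrite ?vf ?va ?vb.
Qed.

Definition Alg (A : Type) (C : clone A) : structure L_Alg (ambient A) :=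
  Structure (@Alg_interp_univ A C).

Definition Act (A : Type) (C : clone A) : structure L_Act (ambient A) :=
  Structure (@Act_interp_univ A C).

Inductive Alg_FTcln : structure_class L_Alg :=
| Alg_FTcln_intro (A : Type) (C : clone A) :
    K_FTcln C -> Alg_FTcln (Alg C).

Inductive Act_FTcln : structure_class L_Act :=
| Act_FTcln_intro (A : Type) (C : clone A) :
    K_FTcln C -> Act_FTcln (Act C).

Inductive R_FTcln : structure_relation L_Alg L_Act :=
| R_FTcln_intro (A : Type) (C : clone A) :
    K_FTcln C -> R_FTcln (Alg C) (Act C).

(* Main.v *)
From Stdlib Require Import Eqdep_dec.
From mathcomp Require Import all_boot.
From mathcomp Require Import all_classical.
Require Import Defs.

(** Write U for the monoid of unary operations of the clone C. A transposition is
    recognised in U as a non-trivial involution t, not commuting with all of its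
    conjugates, such that (t t')^6 = 1 for every conjugate t'; the triple
    transpositions of a six-element set also have this property, and nothing else
    does. A point p is coded by a pair of transpositions (p x), (p y) with x <> y,
    and an operation f by the pair (f, f).

    Since (x a_i) is in C, f(a_1, ..., a_n) is the value at x of the unary operation
    f((x a_1), ..., (x a_n)), so it is enough to define "h x = b" for h in U.
    If U contains a constant then it contains all of them, and h x = b amounts to
    h o (const x) = const b. If h is injective, conjugating the transpositions (x y)
    by h determines h x. In the remaining case some k in U identifies two points
    and takes at least three values; the kernels of the maps k' in U then determine
    the pair {h x, h y} whenever h x <> h y, and two such pairs meet in h x only. *)

Set Implicit Arguments.
Unset Strict Implicit.
Unset Printing Implicit Defensive.

Local Open Scope card_scope.
Local Open Scope classical_set_scope.

(** * Transpositions *)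

(** Equality on [A] is decided classically. For [a = b] this is the identity, so no disequality has
    to accompany every use. *)
Definition swap (A : Type) (a b x : A) : A :=
  if pselect (x = a) then b else if pselect (x = b) then a else x.

Ltac swap_cases := rewrite /swap /=; repeat (case: pselect => /= ?); congruence.

(** Boolean equality on [{classic A}] unfolds to [pselect]. The tactic reduces [uniq] of an explicit
    list to pairwise disequalities, each left to [congruence]. *)
Ltac uniq_congruence :=
  rewrite /= !inE !negb_or; repeat (apply/andP; split) => //;
  match goal with |- context [pselect (@eq _ ?x ?y)] =>
    let T := type of x in
    suff : ~ @eq T x y by [case: pselect => // /[swap] /[apply]]
  end;
  congruence.

Section Swap.
Context (A : Type).
Implicit Types a b c x : A.

Lemma swapL a b : swap a b a = b.
Proof. by swap_cases. Qed.

Lemma swapR a b : swap a b b = a.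
Proof. by swap_cases. Qed.

Lemma swapD a b x : x <> a -> x <> b -> swap a b x = x.
Proof. by move=> ? ?; swap_cases. Qed.

Lemma swap_sym a b : swap a b = swap b a.
Proof. by apply/funext => x; swap_cases. Qed.

Lemma swapK a b x : swap a b (swap a b x) = x.
Proof. by swap_cases. Qed.

Lemma swap_inj a b : injective (swap a b).
Proof. exact: can_inj (swapK a b). Qed.

Lemma swap_neq_id a b : a <> b -> swap a b <> id.
Proof. by move=> ab /(congr1 (fun f => f a)); rewrite swapL => /esym. Qed.

Lemma swap_transposition a b : a <> b -> is_transposition (swap a b).
Proof.
move=> ab; split; first by exists (swap a b); exact: swapK.
exists a, b; split=> // x; split=> [|[->|->]].
- by case: (pselect (x = a)) => [|xa]; [left|case: (pselect (x = b)) => [|xb]; [right|rewrite swapD]].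
- by rewrite swapL => /esym.
- by rewrite swapR.
Qed.

Lemma swap_conj (g : A -> A) a b : injective g ->
  swap (g a) (g b) \o g = g \o swap a b.
Proof.
move=> g_inj; apply/funext => x /=.
case: (pselect (x = a)) => [->|xa]; first by rewrite !swapL.
case: (pselect (x = b)) => [->|xb]; first by rewrite !swapR.
by rewrite !swapD // => /g_inj.
Qed.

Lemma swap_comm_disjoint a b c d : a <> c -> a <> d -> b <> c -> b <> d ->
  swap a b \o swap c d = swap c d \o swap a b.
Proof. by move=> *; apply/funext => x; swap_cases. Qed.

Lemma swap_comm_meet a b c : a <> b -> a <> c -> b <> c ->
  swap a b \o swap a c <> swap a c \o swap a b.
Proof.
move=> ab ac bc /(congr1 (fun f => f a)) /=.
by rewrite !swapL !swapD //; apply: nesym.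
Qed.

Lemma swap_pair a b c d : a <> b -> c <> d -> swap a b = swap c d ->
  (a = c /\ b = d) \/ (a = d /\ b = c).
Proof.
move=> ab cd /(congr1 (fun f => f a)); rewrite swapL /swap.
case: pselect => /= ac; first by move=> <-; left.
by case: pselect => /= ad bE; [right|case: ab].
Qed.

Lemma comp_swap_eq (k : A -> A) a b : k \o swap a b = k <-> k a = k b.
Proof.
split=> [/(congr1 (fun f => f a)) /=|kab]; first by rewrite swapL.
by apply/funext => x /=; swap_cases.
Qed.

End Swap.

(** The equation z^6 = 1, bracketed as the square of the cube so that it can be expressed by saying
    that the cube is an involution. *)
Definition order_dvd6 (A : Type) (z : A -> A) : Prop :=
  (z \o z) \o z \o ((z \o z) \o z) = id.

(** The product is the identity when the pairs coincide, a 3-cycle when they share one point, and an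
    involution when they are disjoint. *)
Lemma order_dvd6_swap (A : Type) (a b c d : A) :
  a <> b -> c <> d -> order_dvd6 (swap a b \o swap c d).
Proof.
have meet (p q r : A) : p <> q -> p <> r -> q <> r ->
    order_dvd6 (swap p q \o swap p r).
  move=> pq pr qr; set z := _ \o _.
  have z3 : z \o z \o z = id.
    have zp : z p = r by rewrite /z /= swapL swapD //; congruence.
    have zq : z q = p by rewrite /z /= (@swapD _ p r) ?swapR //; congruence.
    have zr : z r = q by rewrite /z /= swapR swapL.
    apply/funext => x /=.
    case: (pselect (x = p)) => [->|xp]; first by rewrite zp zr zq.
    case: (pselect (x = q)) => [->|xq]; first by rewrite zq zp zr.
    case: (pselect (x = r)) => [->|xr]; first by rewrite zr zq zp.
    by have zx : z x = x; [rewrite /z /= !swapD|rewrite !zx].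
  by rewrite /order_dvd6 z3.
have same (p q : A) : order_dvd6 (swap p q \o swap p q).
  by apply/funext => x /=; rewrite !swapK.
move=> ab cd.
case: (pselect (a = c)) => [E|ac].
  subst c; case: (pselect (b = d)) => [<-//|bd]; exact: meet.
case: (pselect (a = d)) => [E|ad].
  subst d; rewrite (swap_sym c a); case: (pselect (b = c)) => [<-//|bc].
  exact: meet.
case: (pselect (b = c)) => [E|bc].
  by subst c; rewrite (swap_sym a b); apply: meet => //; congruence.
case: (pselect (b = d)) => [E|bd].
  by subst d; rewrite (swap_sym a b) (swap_sym c b); apply: meet => //; congruence.
have H x : swap a b (swap c d x) = swap c d (swap a b x).
  exact: (congr1 (fun f => f x) (swap_comm_disjoint ac ad bc bd)).
by apply/funext => x /=; do !rewrite !H !swapK.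
Qed.

(** * Recognising transpositions inside a monoid of unary maps *)

Section TranspositionMonoid.
Context (A : Type) (U : set (A -> A)).

Definition transposition_monoid : Prop :=
  [/\ U id, forall f g, U f -> U g -> U (f \o g)
    & forall a b, a <> b -> U (swap a b)].

Definition invertible (g : A -> A) : Prop :=
  U g /\ exists2 g', U g' & g \o g' = id /\ g' \o g = id.

Definition conjugate (t t' : A -> A) : Prop :=
  U t' /\ exists2 g, invertible g & t' \o g = g \o t.

Definition transpositional (t : A -> A) : Prop :=
  [/\ U t, t <> id, t \o t = id,
      exists2 t', conjugate t t' & t \o t' <> t' \o t
    & forall t', conjugate t t' -> order_dvd6 (t \o t')].

Hypothesis HU : transposition_monoid.
Hypothesis third : forall a b : A, exists2 c, c <> a & c <> b.

Lemma monoid_swap a b : U (swap a b).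
Proof.
case: HU => U1 _ Us; case: (pselect (a = b)) => [->|]; last exact: Us.
by have -> : swap b b = id; [apply/funext => x; swap_cases|].
Qed.

Lemma invertible_swap a b : invertible (swap a b).
Proof.
split; first exact: monoid_swap.
exists (swap a b); first exact: monoid_swap.
by split; apply/funext => x; exact: swapK.
Qed.

Lemma invertible_comp f g : invertible f -> invertible g -> invertible (f \o g).
Proof.
case: HU => _ Uc _ [Uf [f' Uf' [ff' f'f]]] [Ug [g' Ug' [gg' g'g]]].
split; first exact: Uc.
exists (g' \o f'); first exact: Uc.
by split; apply/funext => x /=;
  [rewrite -[g (g' _)]/((g \o g') _) gg' -[RHS]/(id x) -ff'
  |rewrite -[f' (f _)]/((f' \o f) _) f'f -[RHS]/(id x) -g'g].
Qed.

Lemma invertible_inj g : invertible g -> injective g.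
Proof.
move=> [_ [g' _ [_ g'g]]]; apply: (can_inj (g := g')) => x.
exact: (congr1 (fun f => f x) g'g).
Qed.

Lemma conjugate_by t g : U t -> invertible g ->
  exists2 t', conjugate t t' & forall x, t' (g x) = g (t x).
Proof.
case: HU => _ Uc _ Ut Ig; have [Ug [g' Ug' [gg' g'g]]] := Ig.
have E x : g' (g x) = x := congr1 (fun f => f x) g'g.
exists (g \o t \o g') => [|x /=]; last by rewrite E.
split; first by apply: (Uc) => //; apply: (Uc).
by exists g => //; apply/funext => x /=; rewrite E.
Qed.

Lemma transpositional_swap a b : a <> b -> transpositional (swap a b).
Proof.
move=> ab; split.
- exact: monoid_swap.
- exact: swap_neq_id.
- by apply/funext => x /=; exact: swapK.
(* Conjugating [(a b)] by [(b c)] gives [(a c)], which meets [(a b)] in the single point [a] and so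
   does not commute with it. *)
- have [c ca cb] := third a b.
  exists (swap a c).
    split; first exact: monoid_swap.
    exists (swap b c); first exact: invertible_swap.
    rewrite -[RHS]swap_conj; last exact: swap_inj.
    by rewrite swapL (swapD ab) //; apply: nesym.
  by apply: swap_comm_meet; apply: nesym => //; apply: nesym.
- move=> t' [_ [g Ig E]].
  have gi := invertible_inj Ig.
  have [_ [g' _ [gg' _]]] := Ig.
  have -> : t' = swap (g a) (g b).
    have E' : t' \o g = swap (g a) (g b) \o g by rewrite swap_conj.
    apply/funext => x; rewrite -[x]/(id x) -gg' /=.
    exact: (congr1 (fun f => f (g' x)) E').
  by apply: order_dvd6_swap => // /gi.
Qed.

Lemma conjugate_invol t t' : t \o t = id -> conjugate t t' -> t' \o t' = id.
Proof.
move=> tt [_ [g [_ [g' _ [gg' _]]] E]].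
have E1 x : t' (g x) = g (t x) := congr1 (fun f => f x) E.
have E2 x : t (t x) = x := congr1 (fun f => f x) tt.
have E3 x : g (g' x) = x := congr1 (fun f => f x) gg'.
by apply/funext => x /=; rewrite -[x]E3 !E1 E2.
Qed.

Lemma conjugate_fixfree t t' : (forall x, t x <> x) -> conjugate t t' ->
  forall x, t' x <> x.
Proof.
move=> fx [_ [g Ig E]] x; have gi := invertible_inj Ig.
have [_ [g' _ [gg' _]]] := Ig.
have E3 : g (g' x) = x := congr1 (fun f => f x) gg'.
rewrite -E3 -[t' _]/((t' \o g) _) E /= => /gi; exact: fx.
Qed.

(** The converse excludes an involution with two 2-cycles. If it has a fixed point, or eight points
    are available, some [t \o t'] has a cycle of length 5 or 4, against z^6 = 1. Without fixed
    points on four points it commutes with all its conjugates. Exactly six points are ruled out by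
    hypothesis. *)
Lemma transpositionalP t :
  (forall s : seq {classic A}, uniq s -> size s = 6 -> exists r, r \notin s) ->
  transpositional t <-> exists a b, a <> b /\ t = swap a b.
Proof.
move=> not6; split=> [[Ut tid tt [u ut tu] t6]|[a [b [ab ->]]]]; last first.
  exact: transpositional_swap.
have tK x : t (t x) = x := congr1 (fun f => f x) tt.
have ti : injective t := can_inj tK.
have z6 t' x : conjugate t t' -> t (t' (t (t' (t (t' (t (t' (t (t' (t (t' x))))))))))) = x.
  by move=> /t6 /(congr1 (fun f => f x)).
have [a ta] : exists a, t a <> a.
  by apply: contra_notP tid => H; apply/funext => x; apply: contra_notP H; exists x.
have {ta} [b tab ab] : exists2 b, t a = b & a <> b by exists (t a); [|exact: nesym].
have tba : t b = a by rewrite -tab tK.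
exists a, b; split=> //; apply: contrapT => tN.
have [c [tc ca cb]] : exists c, [/\ t c <> c, c <> a & c <> b].
  apply: contra_notP tN => H; apply/funext => x.
  case: (pselect (x = a)) => [->|xa]; first by rewrite swapL.
  case: (pselect (x = b)) => [->|xb]; first by rewrite swapR.
  by rewrite swapD //; apply: contra_notP H; exists x.
have {tc} [d tcd cd] : exists2 d, t c = d & c <> d by exists (t c); [|exact: nesym].
have tdc : t d = c by rewrite -tcd tK.
have da : d <> a by move=> E; apply: cb; rewrite -tdc E.
have db : d <> b by move=> E; apply: ca; rewrite -tdc E.
(* With t = (a b)(c d)... and a fixed point e, conjugating by (a c e) makes t t' a
   5-cycle on a, b, c, d, e. *)
case: (pselect (exists e, t e = e)) => [[e te]|ffix].
  have [ea eb ec ed] : [/\ e <> a, e <> b, e <> c & e <> d] by split; congruence.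
  have [||t' ct E] := @conjugate_by t (swap a c \o swap c e) => //.
    by apply: invertible_comp; apply: invertible_swap.
  have ga : (swap a c \o swap c e) a = c by rewrite /= (@swapD _ c) ?swapL //; congruence.
  have gc : (swap a c \o swap c e) c = e by rewrite /= swapL swapD.
  have ge : (swap a c \o swap c e) e = a by rewrite /= !swapR.
  have gb : (swap a c \o swap c e) b = b by rewrite /= !swapD //; congruence.
  have gd : (swap a c \o swap c e) d = d by rewrite /= !swapD //; congruence.
  move: (E a) (E b) (E c) (E d) (E e).
  rewrite tab tba tcd tdc te ga gb gc gd ge => Ea Eb Ec Ed Ee.
  have := z6 _ a ct.
  by rewrite !(Ea, Eb, Ec, Ed, Ee, tab, tba, tcd, tdc, te) => /nesym.
have fx x : t x <> x by move=> E; apply: ffix; exists x.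
(* On four points, conjugates of a double transposition commute. *)
case: (pselect (exists p, [/\ p <> a, p <> b, p <> c & p <> d])); last first.
  move=> H; case: tu; have uf := conjugate_fixfree fx ut.
  have uu := conjugate_invol tt ut.
  have uK x : u (u x) = x := congr1 (fun f => f x) uu.
  apply/funext => x /=; apply: contrapT => tux.
  have uxt : u x <> t x by move=> E; apply: tux; rewrite E tK -E uK.
  (* Both involutions are fixed-point-free, so if [t] and [u] disagree on their order at [x], these
     five points are distinct, too many for a four-point set. *)
  pose s : seq {classic A} := [:: x; t x; u x; t (u x); u (t x)].
  have us : uniq s.
    have [[uK1 uK2] [tK1 tK2]] := ((uK x, uK (t x)), (tK x, tK (u x))).
    have [[fx1 fx2] [uf1 uf2]] := ((fx x, fx (u x)), (uf x, uf (t x))).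
    rewrite /s; uniq_congruence.
  suff : (size s <= size [:: a : {classic A}; b; c; d])%N by [].
  apply: uniq_leq_size => // y _.
  have [] : [\/ y = a, y = b, y = c | y = d].
    by apply: contra_notP H => H; exists y; split=> E; apply: H;
      [apply: Or41|apply: Or42|apply: Or43|apply: Or44].
  - by move=> ->; exact: mem_head.
  - by move=> ->; apply: mem_behead; exact: mem_head.
  - by move=> ->; do 2!apply: mem_behead; exact: mem_head.
  - by move=> ->; do 3!apply: mem_behead; exact: mem_head.
move=> [p [pa pb pc pd]].
have [q tpq pq] : exists2 q, t p = q & p <> q by exists (t p) => //; apply: nesym.
have tqp : t q = p by rewrite -tpq tK.
have [qa qb qc qd] : [/\ q <> a, q <> b, q <> c & q <> d] by split; congruence.
(* Here the exclusion of six points is used: a seventh point [r] exists, and [t r] is then an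
   eighth. *)
have [r [[ra rb rc rd] [rp rq]]] :
    exists r : A, [/\ r <> a, r <> b, r <> c & r <> d] /\ r <> p /\ r <> q.
  have [||r] := not6 [:: a; b; c; d; p; q] => //.
    uniq_congruence.
  move=> rN; have {}rN x : x \in [:: a : {classic A}; b; c; d; p; q] -> r <> x.
    by move=> xs E; rewrite E xs in rN.
  by exists r; split; [split|split]; apply: rN; do ?[exact: mem_head|apply: mem_behead].
have [s trs rs] : exists2 s, t r = s & r <> s by exists (t r) => //; apply: nesym.
have tsr : t s = r by rewrite -trs tK.
have [sa sb sc sd] : [/\ s <> a, s <> b, s <> c & s <> d] by split; congruence.
have [sp sq] : s <> p /\ s <> q by split; congruence.
(* With t = (a b)(c d)(p q)(r s)..., conjugating by (a c p r) makes t t' a 4-cycle on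
   a, c, p, r. *)
have [||t' ct E] := @conjugate_by t (swap a c \o (swap c p \o swap p r)) => //.
  by do !apply: invertible_comp; apply: invertible_swap.
have gD x : x <> a -> x <> c -> x <> p -> x <> r ->
  (swap a c \o (swap c p \o swap p r)) x = x by move=> *; rewrite /= !swapD.
have ga : (swap a c \o (swap c p \o swap p r)) a = c.
  by rewrite /= (@swapD _ p) ?(@swapD _ c) ?swapL //; congruence.
have gc : (swap a c \o (swap c p \o swap p r)) c = p.
  by rewrite /= (@swapD _ p) ?swapL ?swapD //; congruence.
have gp : (swap a c \o (swap c p \o swap p r)) p = r.
  by rewrite /= swapL !swapD //; congruence.
have gr : (swap a c \o (swap c p \o swap p r)) r = a.
  by rewrite /= !swapR.
have [gb gd] := (gD b (nesym ab) (nesym cb) (nesym pb) (nesym rb),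
  gD d da (nesym cd) (nesym pd) (nesym rd)).
have [gq gs] := (gD q qa qc (nesym pq) (nesym rq), gD s sa sc sp (nesym rs)).
move: (E b) (E d) (E q) (E s) (E a) (E c) (E p) (E r).
rewrite gb gd gq gs ga gc gp gr tab tba tcd tdc tpq tqp trs tsr.
rewrite gb gd gq gs ga gc gp gr => Eb Ed Eq Es Ea Ec Ep Er.
(* The sixth power of a 4-cycle is its square, which sends [c] to [r]. *)
have := z6 _ c ct.
by rewrite !(Ea, Eb, Ec, Ed, Ep, Eq, Er, Es, tab, tba, tcd, tdc, tpq, tqp, trs, tsr).
Qed.

End TranspositionMonoid.

(** * The excluded cardinalities turned into existence of further points *)

Lemma card_eq_seq (A : Type) (x0 : A) (s : seq {classic A}) :
  uniq s -> (forall x, x \in s) -> [set: A] #= `I_(size s).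
Proof.
move=> us sA; have -> : [set: A] = nth (x0 : {classic A}) s @` `I_(size s).
  apply/seteqP; split=> // x _; exists (index (x : {classic A}) s) => /=.
    by rewrite index_mem.
  exact: nth_index.
apply: inj_card_eq => i j; rewrite !in_setE /= => si sj.
exact: (uniqP (x0 : {classic A}) us).
Qed.

Lemma third_point (A : Type) : [set: A] #!= `I_1 -> [set: A] #!= `I_2 ->
  forall a b : A, exists2 c, c <> a & c <> b.
Proof.
move=> N1 N2 a b; apply: contrapT => H.
have {}H c : c = a \/ c = b.
  by apply: contra_notP H => H; exists c => E; apply: H; [left|right].
case: (pselect (a = b)) => [E|ab].
  move/negP: N1; apply; apply: (@card_eq_seq _ a [:: a]) => // x.
  by case: (H x) => [->|->]; rewrite -?E mem_head.
move/negP: N2; apply; apply: (@card_eq_seq _ a [:: a; b]) => [|x].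
  uniq_congruence.
by case: (H x) => ->; do ?[exact: mem_head|apply: mem_behead].
Qed.

Lemma outside_six (A : Type) : [set: A] #!= `I_6 ->
  forall s : seq {classic A}, uniq s -> size s = 6 -> exists r, r \notin s.
Proof.
move=> N6 s us s6; apply: contrapT => H; move/negP: N6; apply.
have x0 : A by case: s s6 {us H} => // x.
rewrite -s6; apply: (card_eq_seq x0 us) => x.
by apply: contra_notT H => xs; exists x.
Qed.

(** * Evaluating unary operations *)

Definition constant (A : Type) (Z : A -> A) : Prop := forall p q, Z p = Z q.

(** The value of [Z] is described through composition alone: it is [b] when every transposition
    [(b c)] changes [Z]. *)
Definition constant_at (A : Type) (Z : A -> A) (b : A) : Prop :=
  constant Z /\ forall c, c <> b -> swap b c \o Z <> Z.

Section Evaluation.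
Context (A : Type) (U : set (A -> A)).
Hypothesis HU : transposition_monoid U.
Hypothesis third : forall a b : A, exists2 c, c <> a & c <> b.

Definition has_constant : Prop := exists2 Z, U Z & constant Z.

Definition evaluates_const (h : A -> A) (x b : A) : Prop :=
  exists2 Zx, U Zx & exists2 Zb, U Zb &
    [/\ constant_at Zx x, constant_at Zb b & h \o Zx = Zb].

(** For injective [h], [h \o swap x y] is [swap (h x) (h y) \o h]. Comparing at [x] shows that [b]
    is [h x] or [h y], and [y] varies. *)
Definition evaluates_inj (h : A -> A) (x b : A) : Prop :=
  injective h /\ forall y, y <> x -> exists2 c, c <> b &
    h \o swap x y = swap b c \o h.

(** The condition on [k] says that the pairs [{h x, h y}] and [{b, v}] are collapsed by the same
    members of [U]; without constants this forces them to be equal. *)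
Definition evaluates_noninj (h : A -> A) (x b : A) : Prop :=
  ~ injective h /\ forall y, h x <> h y -> exists2 v, v <> b &
    forall k, U k -> (k \o h) x = (k \o h) y <-> k b = k v.

Definition evaluates (h : A -> A) (x b : A) : Prop :=
  evaluates_const h x b \/
  (~ has_constant /\ (evaluates_inj h x b \/ evaluates_noninj h x b)).

Lemma constant_atP (Z : A -> A) (b : A) : constant_at Z b <-> Z = (fun=> b).
Proof.
split=> [[ZC Zb]|->]; last first.
  by split=> // c cb /(congr1 (fun f => f b)); rewrite /= swapL.
apply/funext => p; apply: contrapT => Zpb.
(* If the value [Z p] is not [b], a transposition [(b c)] with [c] also different from [Z p] leaves
   [Z] unchanged. *)
have [c cb cZ] := third b (Z p); apply: (Zb c cb).
by apply/funext => q /=; rewrite (ZC q p) swapD //; exact: nesym.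
Qed.

Lemma monoid_constant b : has_constant -> U (fun=> b).
Proof.
move=> [Z UZ ZC]; have -> : (fun=> b) = swap (Z b) b \o Z.
  by apply/funext => p /=; rewrite (ZC p b) swapL.
by case: HU => _ Uc _; apply: Uc => //; exact: monoid_swap.
Qed.

Lemma monoid_two_transitive (u w a b : A) : u <> w -> a <> b ->
  exists g, [/\ U g, injective g, g u = a & g w = b].
Proof.
(* After [(u a)] has sent [u] to [a], the point [w] sits at [w1], which is not [a]; [(w1 b)] moves
   it to [b] without touching [a]. *)
move=> uw ab; pose w1 := swap u a w.
have w1a : w1 <> a by move=> E; apply: uw; apply: (@swap_inj _ u a); rewrite swapL; exact: esym.
exists (swap w1 b \o swap u a); split=> /=.
- by case: HU => _ Uc _; apply: Uc; exact: monoid_swap.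
- exact: inj_comp (@swap_inj _ _ _) (@swap_inj _ _ _).
- by rewrite swapL swapD //; exact: nesym.
- by rewrite swapL.
Qed.

(* If k took only the values k p = k q and k r, then k o g o k would be constant for
   any permutation g mapping these two values to p and q. *)
Lemma three_values k : ~ has_constant -> U k -> ~ injective k ->
  exists p q r s, p <> q /\ k p = k q /\ [/\ k r <> k p, k s <> k p & k r <> k s].
Proof.
move=> NC Uk Nk.
have [p [q [pq kpq]]] : exists p q, p <> q /\ k p = k q.
  apply: contra_notP Nk => H p q kpq; apply: contrapT => pq.
  by apply: H; exists p, q.
have [r krp] : exists r, k r <> k p.
  apply: contra_notP NC => H; exists k => // x y.
  have kp z : k z = k p by apply: contrapT => N; apply: H; exists z.
  by rewrite !kp.
exists p, q, r; apply: contrapT => H.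
have k2 s : k s = k p \/ k s = k r.
  apply: contra_notP H => H; exists s; split=> //; split=> //; split=> // E.
    by apply: H; left.
  by apply: H; right.
have [g [Ug _ gp gr]] := monoid_two_transitive (nesym krp) pq.
apply: NC; exists (k \o g \o k); first by case: HU => _ Uc _; exact: (Uc (k \o g) k (Uc k g Uk Ug) Uk).
suff kgk s : k (g (k s)) = k p by move=> x y; rewrite /= !kgk.
by case: (k2 s) => ->; rewrite ?gp ?gr.
Qed.

(** Take [k] with [k p = k q] and three values, and a permutation [g] sending [u], [w] to [p], [q].
    Then [k \o g] collapses [u], [w], hence also [b], [v]. If [g b] lay outside [{p, q}], a
    transposition could move it to a point with another [k]-value, so that [b], [v] are separated
    while [u], [w] stay collapsed. The same holds for [v]. *)
Lemma kernels_determine_pair k u w b v : ~ has_constant -> U k -> ~ injective k ->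
  u <> w -> b <> v -> (forall k, U k -> k u = k w <-> k b = k v) ->
  (u = b /\ w = v) \/ (u = v /\ w = b).
Proof.
move=> NC Uk Nk uw bv kE.
have [p [q [r [s [pq [kpq [krp ksp krs]]]]]]] := three_values NC Uk Nk.
have [g [Ug gi gu gw]] := monoid_two_transitive uw pq.
have [_ Uc _] := HU.
have kbv : k (g b) = k (g v).
  by apply/(kE (k \o g) _); [apply: Uc|rewrite /= gu gw].
have gbv : g b <> g v by move/gi.
have off x y : g x <> p -> g x <> q -> g x <> g y -> k (g x) = k (g y) ->
    ~ forall k, U k -> k u = k w <-> k x = k y.
  move=> xp xq xy kxy H.
  (* With three values available, one of [r], [s] avoids both [k p] and [k (g y)]; avoiding [k p]
     keeps [z] away from [p] and [q]. *)
  have [z kzp kzy] : exists2 z, k z <> k p & k z <> k (g y).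
    case: (pselect (k r = k (g y))) => [kry|]; last by exists r.
    by exists s => //; rewrite -kry; exact: nesym.
  have [|E _] := H (k \o (swap (g x) z \o g)).
    by apply: (Uc) => //; apply: (Uc) => //; exact: monoid_swap.
  have zp : p <> z by move=> pz; rewrite -pz in kzp.
  have zq : q <> z by move=> qz; rewrite -qz -kpq in kzp.
  have zy : g y <> z by move=> yz; rewrite -yz in kzy.
  move: E; rewrite /= gu gw swapL !swapD //; try exact: nesym.
  by move=> /(_ kpq).
have mem x y : g x <> g y -> k (g x) = k (g y) ->
    (forall k, U k -> k u = k w <-> k x = k y) -> x = u \/ x = w.
  move=> xy kxy H; apply: contrapT => N; apply: (off x y) => // E; apply: N.
    by left; apply: gi; rewrite gu.
  by right; apply: gi; rewrite gw.
have vE : forall k, U k -> k u = k w <-> k v = k b.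
  by move=> k' Uk'; rewrite kE //; split=> /esym.
have [bu|bw] := mem _ _ gbv kbv kE;
have [vu|vw] := mem _ _ (nesym gbv) (esym kbv) vE; try congruence.
- by left.
- by right.
Qed.

Lemma evaluatesP h x b : U h -> evaluates h x b <-> h x = b.
Proof.
move=> Uh; split=> [|<-].
  case=> [[Zx _ [Zb _ [/constant_atP -> /constant_atP -> /(congr1 (fun f => f x))]]] //|].
  move=> [NC [[hi H]|[Nh H]]]; apply: contrapT => hxb.
    (* Supposing [h x <> b], all points other than [x] are sent to [b], and there are two of them,
       against injectivity. *)
    have hb y : y <> x -> h y = b.
      move=> yx; have [c cb /(congr1 (fun f => f x))] := H y yx.
      rewrite /= swapL; case: (pselect (h x = c)) => [->|hxc]; first by rewrite swapR.
      by rewrite swapD // => /hi.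
    have [y yx _] := third x x; have [z zx zy] := third x y.
    by apply: zy; apply: hi; rewrite !hb.
  (* The map [h] itself is non-injective, so it takes three values. Supposing [h x <> b], every
     value other than [h x] would be [b], leaving only two. *)
  have [p [q [r [s [pq [kpq [krp ksp krs]]]]]]] := three_values NC Uh Nh.
  have hb y : h x <> h y -> h y = b.
    move=> hxy; have [v vb E] := H y hxy.
    by have [[]|[]] := kernels_determine_pair NC Uh Nh hxy (nesym vb) E.
  case: (pselect (h x = h p)) => [hxp|/hb hp].
    by case: krs; transitivity b; [|symmetry]; apply: hb; rewrite hxp; exact: nesym.
  case: (pselect (h x = h r)) => [hxr|/hb hr]; last by apply: krp; rewrite hp.
  by apply: ksp; rewrite hp; apply: hb; rewrite hxr.
case: (pselect has_constant) => [C|NC].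
  left; exists (fun=> x); first exact: monoid_constant.
  exists (fun=> h x); first exact: monoid_constant.
  by split=> //; apply/constant_atP.
right; split=> //; case: (pselect (injective h)) => [hi|Nh]; [left|right]; split=> // y.
  by move=> yx; exists (h y) => [/hi //|]; rewrite swap_conj.
by move=> hxy; exists (h y) => //; exact: nesym.
Qed.

End Evaluation.

(** * Formulas *)

Section Formulas.
Context (L : language).

Fixpoint rename (V : Type) (phi : formula L V) : forall W : Type, (V -> W) -> formula L W :=
  match phi with
  | fEq x y => fun W r => fEq L (r x) (r y)
  | fRel P v => fun W r => fRel (fun i => r (v i))
  | fNot p => fun W r => fNot (rename p r)
  | fAnd p q => fun W r => fAnd (rename p r) (rename q r)
  | fOr p q => fun W r => fOr (rename p r) (rename q r)
  | fImp p q => fun W r => fImp (rename p r) (rename q r)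
  | fAll p => fun W r => fAll (rename p (omap r))
  | fEx p => fun W r => fEx (rename p (omap r))
  end.

(** The syntax has no truth constant, so the conjunction ends in a given formula [phi]. *)
Definition fConj (V : Type) n (f : 'I_n -> formula L V) (phi : formula L V) :=
  foldr (fun i p => fAnd (f i) p) phi (enum 'I_n).

(** The last of the [n.+1] block variables becomes the bound variable [None]; [fExs] therefore binds
    it by the innermost quantifier. *)
Definition unshift (V : Type) n (x : V + 'I_n.+1) : option (V + 'I_n) :=
  match x with
  | inl v => Some (inl v)
  | inr i => omap inr (unlift ord_max i)
  end.

Definition drop0 (V : Type) (x : V + 'I_0) : V :=
  match x with inl v => v | inr i => False_rect V (notF (ltn_ord i)) end.

Fixpoint fExs (n : nat) (V : Type) : formula L (V + 'I_n) -> formula L V :=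
  match n return formula L (V + 'I_n) -> formula L V with
  | 0 => fun phi => rename phi (@drop0 V)
  | m.+1 => fun phi => fExs (fEx (rename phi (@unshift V m)))
  end.

Context (U : Type) (M : structure L U).

Lemma sat_fEq V (x y : V) e : sat M (fEq L x y) e <-> (e x = e y).
Proof. by []. Qed.

Lemma sat_fNot V (p : formula L V) e : sat M (fNot p) e <-> (~ sat M p e).
Proof. by []. Qed.

Lemma sat_fAnd V (p q : formula L V) e :
  sat M (fAnd p q) e <-> (sat M p e /\ sat M q e).
Proof. by []. Qed.

Lemma sat_fOr V (p q : formula L V) e :
  sat M (fOr p q) e <-> (sat M p e \/ sat M q e).
Proof. by []. Qed.

Lemma sat_fImp V (p q : formula L V) e :
  sat M (fImp p q) e <-> (sat M p e -> sat M q e).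
Proof. by []. Qed.

Lemma sat_fAll V (p : formula L (option V)) e :
  sat M (fAll p) e <-> (forall b, univ M b -> sat M p (assign e b)).
Proof. by []. Qed.

Lemma sat_fEx V (p : formula L (option V)) e :
  sat M (fEx p) e <-> (exists2 b, univ M b & sat M p (assign e b)).
Proof. by []. Qed.

Lemma assign_omap V W (r : V -> W) (e : W -> U) b :
  assign e b \o omap r = assign (e \o r) b.
Proof. by apply/funext; case. Qed.

Lemma sat_rename V (phi : formula L V) W (r : V -> W) e :
  sat M (rename phi r) e <-> sat M phi (e \o r).
Proof.
elim: phi W r e => {V} //=.
- by move=> V p IH W r e; rewrite IH.
- by move=> V p IHp q IHq W r e; rewrite IHp IHq.
- by move=> V p IHp q IHq W r e; rewrite IHp IHq.
- by move=> V p IHp q IHq W r e; rewrite IHp IHq.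
- by move=> V p IH W r e; split=> H b Mb; move: (H b Mb); rewrite IH assign_omap.
- by move=> V p IH W r e; split=> -[b Mb H]; exists b => //; move: H; rewrite IH assign_omap.
Qed.

Lemma sat_fConj V n (f : 'I_n -> formula L V) phi e :
  sat M (fConj f phi) e <-> (forall i, sat M (f i) e) /\ sat M phi e.
Proof.
rewrite /fConj; have -> : (forall i, sat M (f i) e) <-> (forall i, i \in enum 'I_n -> sat M (f i) e).
  by split=> H i //; apply: H; rewrite mem_enum.
elim: (enum 'I_n) => [|i s IH] /=; first by split=> [//|[]].
rewrite IH; split=> [[fi [H ?]]|[H ?]].
  by split=> // j; rewrite inE => /orP[/eqP ->|/H].
split; first by apply: H; rewrite inE eqxx.
by split=> // j js; apply: H; rewrite inE js orbT.
Qed.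

Definition assigns (V : Type) n (e : V -> U) (g : 'I_n -> U) (x : V + 'I_n) : U :=
  match x with inl v => e v | inr i => g i end.

Lemma sat_fExs n V (phi : formula L (V + 'I_n)) e :
  sat M (fExs phi) e <->
  exists2 g : 'I_n -> U, forall i, univ M (g i) & sat M phi (assigns e g).
Proof.
elim: n V phi e => [|n IH] V phi e /=.
  split=> [/sat_rename H|[g _ H]]; last apply/sat_rename.
    exists (fun i => e (drop0 (inr i))) => [[]//|].
    by move: H; congr (sat _ _ _); apply/funext => -[//|[]].
  by move: H; congr (sat _ _ _); apply/funext => -[//|[]].
split=> [/IH[g Mg [b Mb /sat_rename H]]|[g Mg H]].
  exists (fun i => if unlift ord_max i is Some j then g j else b) => [i|].
    by case: unliftP.
  by move: H; congr (sat _ _ _); apply/funext => -[//|i] /=; case: unliftP.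
apply/IH; exists (g \o lift ord_max) => [i|] //=.
exists (g ord_max) => //; apply/sat_rename.
by move: H; congr (sat _ _ _); apply/funext => -[//|i] /=; case: unliftP => [j|] ->.
Qed.

End Formulas.

Arguments sat : simpl never.

Definition places (V : Type) n (x : V) (m : 'I_n.+1 -> V) (z : V) (j : 'I_n.+3) : V :=
  if unlift ord0 j is Some k then
    if unlift ord_max k is Some i then m i else z
  else x.

Section Places.
Context (V : Type) (n : nat) (x : V) (m : 'I_n.+1 -> V) (z : V).

Lemma places_fst : places x m z (fst_place n) = x.
Proof. by rewrite /places unlift_none. Qed.

Lemma places_mid i : places x m z (mid_place i) = m i.
Proof. by rewrite /places /mid_place !liftK. Qed.

Lemma places_lst : places x m z (lst_place n) = z.
Proof.
have -> : lst_place n = lift ord0 ord_max by exact/val_inj.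
by rewrite /places liftK unlift_none.
Qed.

End Places.

Definition places_simpl := (places_fst, places_mid, places_lst).

(** * Unary operations of a clone as maps from [A] to [A] *)

Section UnaryOperations.
Context (A : Type).

(** Index 0 stands for arity one. *)
Definition unary (s : A -> A) : operation A := @Op A 0 (fun x => s (x ord0)).

Definition fn (s : A -> A) : ambient A := inl (unary s).

Definition pt (a : A) : ambient A := inr a.

Lemma Op_inj n : injective (@Op A n).
Proof. by move=> f g; exact: (inj_pair2_eq_dec _ (@eq_comparable nat) (op A) n f g). Qed.

Lemma fn_inj : injective fn.
Proof.
move=> s t [/Op_inj E]; apply/funext => a.
exact: (congr1 (fun f => f (fun=> a)) E).
Qed.

Lemma op_unary (f : op A 0) : f = fun x => f (fun=> x ord0).
Proof. by apply/funext => x; congr f; apply/funext => i; rewrite (ord1 i). Qed.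

Context (C : clone A).

Definition unaries : set (A -> A) := [set s | clone_set C (unary s)].

Lemma unaries_monoid : fully_transpositional C -> transposition_monoid unaries.
Proof.
move=> FT; split.
- exact: (@clone_proj A C 0 ord0).
- by move=> f g Uf Ug; exact: (@clone_comp A C 0 0 (fun x => f (x ord0)) (fun _ x => g (x ord0)) Uf (fun=> Ug)).
- by move=> a b ab; exact: FT (swap_transposition ab).
Qed.

Lemma Cmp_relP n (v : 'I_n.+3 -> ambient A) : @Cmp_rel A C n 0 v <->
  exists (f : op A n) (g : 'I_n.+1 -> A -> A),
    [/\ v (fst_place n) = inl (Op f), forall i, v (mid_place i) = fn (g i)
      & v (lst_place n) = fn (fun a => f (fun i => g i a))] /\
    (Fnc C f /\ forall i, unaries (g i)).
Proof.
split=> [[f [g [h [[vf vg vh] [Cf Cg hE]]]]]|[f [g [[vf vg vh] [Cf Cg]]]]].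
  have gE i : Op (g i) = unary (fun a => g i (fun=> a)).
    by rewrite {1}[g i]op_unary.
  exists f, (fun i a => g i (fun=> a)); split; split=> //.
  - by move=> i; rewrite vg gE.
  - by rewrite vh hE [comp f g]op_unary.
  - by move=> i; rewrite /unaries /= -gE; exact: Cg.
by exists f, (fun i x => g i (x ord0)), (fun x => f (fun i => g i (x ord0))).
Qed.

Lemma Cmp_rel_unaryP (x y z : ambient A) :
  @Cmp_rel A C 0 0 (places x (fun=> y) z) <->
  exists s t, [/\ unaries s, unaries t & [/\ x = fn s, y = fn t & z = fn (s \o t)]].
Proof.
rewrite Cmp_relP; split=> [[f [g [[xE yE zE] [Cf Cg]]]]|[s [t [Us Ut [-> -> ->]]]]].
  move: xE (yE ord0) zE; rewrite !places_simpl => xE yE' zE.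
  exists (fun a => f (fun=> a)), (g ord0); split=> //.
    by rewrite /unaries /= /unary -op_unary.
  split=> //; first by rewrite xE [f]op_unary.
  rewrite zE; congr fn; apply/funext => a /=; congr f; apply/funext => i.
  by rewrite (ord1 i).
exists (fun x => s (x ord0)), (fun=> t); split; first by split=> [|i|]; rewrite places_simpl.
by split.
Qed.

End UnaryOperations.

(** * Quantification over unary operations, for any language with a formula for unary composition *)

Section UnaryFormulas.
Context (L : language) (cmp : forall V, V -> V -> V -> formula L V).

(** An element is a unary operation exactly when it can be composed with itself as a unary
    operation. *)
Definition fUn (V : Type) (x : V) : formula L V := fEx (cmp (Some x) (Some x) None).

Definition fExU (V : Type) (phi : formula L (option V)) : formula L V :=
  fEx (fAnd (fUn None) phi).

Definition fAllU (V : Type) (phi : formula L (option V)) : formula L V :=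
  fAll (fImp (fUn None) phi).

Context (A : Type) (C : clone A) (M : structure L (ambient A)).

Definition cmp_spec : Prop := forall V (e : V -> ambient A) (x y z : V),
  sat M (cmp x y z) e <->
  exists s t, [/\ unaries C s, unaries C t & [/\ e x = fn s, e y = fn t & e z = fn (s \o t)]].

Hypothesis HU : transposition_monoid (unaries C).
Hypothesis univ_fn : forall s, unaries C s -> univ M (fn s).
Hypothesis sat_cmp : cmp_spec.

Lemma sat_fUn V (x : V) e :
  sat M (fUn x) e <-> exists2 s, unaries C s & e x = fn s.
Proof.
rewrite /fUn sat_fEx; split=> [[b _ /sat_cmp[s [t [Us _ [xE _ _]]]]]|[s Us xE]].
  by exists s.
case: HU => _ Uc _; exists (fn (s \o s)); first by apply: univ_fn; exact: Uc.
by apply/sat_cmp; exists s, s.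
Qed.

Lemma sat_fExU V (phi : formula L (option V)) e :
  sat M (fExU phi) e <-> exists2 s, unaries C s & sat M phi (assign e (fn s)).
Proof.
rewrite /fExU sat_fEx; split=> [[b _ /sat_fAnd[/sat_fUn[s Us /= -> H]]]|[s Us H]].
  by exists s.
exists (fn s); first exact: univ_fn.
by apply/sat_fAnd; split=> //; apply/sat_fUn; exists s.
Qed.

Lemma sat_fAllU V (phi : formula L (option V)) e :
  sat M (fAllU phi) e <-> forall s, unaries C s -> sat M phi (assign e (fn s)).
Proof.
rewrite /fAllU sat_fAll; split=> [H s Us|H b Mb]; last first.
  by apply/sat_fImp => /sat_fUn[s Us /= ->]; exact: H.
by have /sat_fImp := H _ (univ_fn Us); apply; apply/sat_fUn; exists s.
Qed.

Lemma sat_cmp_fn V (e : V -> ambient A) x y z s t :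
  unaries C s -> unaries C t -> e x = fn s -> e y = fn t ->
  sat M (cmp x y z) e <-> e z = fn (s \o t).
Proof.
move=> Us Ut xE yE; rewrite sat_cmp; split=> [[s' [t' [_ _ []]]]|zE].
  by rewrite xE yE => /fn_inj <- /fn_inj <-.
by exists s, t.
Qed.

End UnaryFormulas.

(** * Transpositions and points in Alg(C) *)

Definition fCmp (V : Type) (x y z : V) : formula L_Alg V :=
  @fRel L_Alg V (Cmp 0 0) (places x (fun=> y) z).

Definition fId (V : Type) (x : V) : formula L_Alg V :=
  fAllU fCmp (fCmp (Some x) None None).

Definition fInv (V : Type) (g : V) : formula L_Alg V :=
  fExU fCmp (fExU fCmp (fAnd (fId None)
    (fAnd (fCmp (Some (Some g)) (Some None) None)
          (fCmp (Some None) (Some (Some g)) None)))).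

Definition fConjugate (V : Type) (t u : V) : formula L_Alg V :=
  fExU fCmp (fAnd (fInv None) (fExU fCmp
    (fAnd (fCmp (Some (Some u)) (Some None) None)
          (fCmp (Some None) (Some (Some t)) None)))).

Definition fCommute (V : Type) (s t : V) : formula L_Alg V :=
  fExU fCmp (fAnd (fCmp (Some s) (Some t) None) (fCmp (Some t) (Some s) None)).

Definition fInvol (V : Type) (t : V) : formula L_Alg V :=
  fExU fCmp (fAnd (fId None) (fCmp (Some t) (Some t) None)).

Definition fDvd6 (V : Type) (z : V) : formula L_Alg V :=
  fExU fCmp (fAnd (fCmp (Some z) (Some z) None)
    (fExU fCmp (fAnd (fCmp (Some None) (Some (Some z)) None) (fInvol None)))).

Definition fTransposition (V : Type) (t : V) : formula L_Alg V :=
  fAnd (fUn fCmp t) (fAnd (fNot (fId t)) (fAnd (fInvol t) (fAnd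
    (fExU fCmp (fAnd (fConjugate (Some t) None) (fNot (fCommute (Some t) None))))
    (fAllU fCmp (fImp (fConjugate (Some t) None)
      (fExU fCmp (fAnd (fCmp (Some (Some t)) (Some None) None) (fDvd6 None)))))))).

(* If s = (p a) and t = (p b), the transpositions commuting with neither are (a b) =
   s t s and the (p c) with c outside {a, b}; excluding r = s t s is expressed by
   r s <> s t. *)
Definition fMoves (V : Type) (r s t : V) : formula L_Alg V :=
  fAnd (fTransposition r) (fOr (fEq _ r s) (fOr (fEq _ r t)
    (fAnd (fNot (fCommute r s)) (fAnd (fNot (fCommute r t)) (fNot
      (fExU fCmp (fAnd (fCmp (Some r) (Some s) None) (fCmp (Some s) (Some t) None)))))))).

(** Two transpositions fail to commute exactly when the pairs they move share one point, and that
    point is the one coded. *)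
Definition fPointCode (V : Type) (s t : V) : formula L_Alg V :=
  fAnd (fTransposition s) (fAnd (fTransposition t) (fNot (fCommute s t))).

(** The two sides differ at [p]. This is the last test of [fMoves] for a transposition that does
    move [p]. *)
Lemma comp_swap_neq_meet (A : Type) (p a b d : A) :
  p <> a -> p <> b -> p <> d -> d <> a ->
  swap p d \o swap p a <> swap p a \o swap p b.
Proof.
move=> pa pb pd da; case: (pselect (a = b)) => [<-|ab] /(congr1 (fun f => f p)) /=.
  by rewrite swapK swapL swapD //; exact: nesym.
by rewrite !swapL !swapD //; exact: nesym.
Qed.

(** If [(c d)] misses [p] but commutes with neither [(p a)] nor [(p b)], it contains [a] and [b], so
    it is [(a b)]; and [(a b)(p a) = (p a)(p b)], which the last condition forbids. *)
Lemma swap_moves (A : Type) (p a b c d : A) :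
  p <> a -> p <> b -> a <> b -> c <> d ->
  (swap c d = swap p a \/ swap c d = swap p b \/
    [/\ swap c d \o swap p a <> swap p a \o swap c d,
        swap c d \o swap p b <> swap p b \o swap c d
      & swap c d \o swap p a <> swap p a \o swap p b]) <-> p = c \/ p = d.
Proof.
move=> pa pb ab cd; split.
  case=> [|[]].
  - by case/(swap_pair cd pa) => -[? ?]; [left|right].
  - by case/(swap_pair cd pb) => -[? ?]; [left|right].
  move=> [Na Nb Nab]; apply: contrapT => N.
  have [cp dp] : c <> p /\ d <> p by split=> E; apply: N; [left|right].
  have acd : a = c \/ a = d.
    apply: contrapT => N'; apply: Na; apply: swap_comm_disjoint => // E; apply: N'; by [left|right].
  have bcd : b = c \/ b = d.
    apply: contrapT => N'; apply: Nb; apply: swap_comm_disjoint => // E; apply: N'; by [left|right].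
  apply: Nab.
  have -> : swap c d = swap a b.
    by case: acd bcd => [?|?] [?|?]; try congruence; rewrite swap_sym; congruence.
  by apply/funext => x; swap_cases.
have main q : p <> q -> (swap p q = swap p a \/ swap p q = swap p b \/
    [/\ swap p q \o swap p a <> swap p a \o swap p q,
        swap p q \o swap p b <> swap p b \o swap p q
      & swap p q \o swap p a <> swap p a \o swap p b]).
  move=> pq; case: (pselect (q = a)) => [->|qa]; first by left.
  case: (pselect (q = b)) => [->|qb]; right; [by left|right].
  by split; [exact: swap_comm_meet|exact: swap_comm_meet|exact: comp_swap_neq_meet].
by case=> E; [subst c|subst d; rewrite (swap_sym c)]; apply: main => //; exact: nesym.
Qed.

(** * Meaning of the transposition and point formulas in Alg(C) *)

Section Satisfaction.
Context (A : Type) (C : clone A).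
Local Notation U := (unaries C).

Lemma univ_Alg_fn s : U s -> univ (Alg C) (fn s).
Proof. by []. Qed.

Lemma map_places V W (e : V -> W) n (x : V) (m : 'I_n.+1 -> V) (z : V) :
  e \o places x m z = places (e x) (e \o m) (e z).
Proof.
apply/funext => j; rewrite /places /=.
by case: unlift => // k; case: unlift.
Qed.

Lemma fCmp_spec : cmp_spec fCmp C (Alg C).
Proof.
move=> V e x y z; rewrite -Cmp_rel_unaryP.
by rewrite -[places (e x) _ _]/(places (e x) (e \o fun=> y) (e z)) -map_places.
Qed.

Hypothesis KC : K_FTcln C.

Let HU : transposition_monoid U.
Proof. by case: KC => FT _ _ _; exact: unaries_monoid. Qed.

Let third (a b : A) : exists2 c, c <> a & c <> b.
Proof. by case: KC => _ N1 N2 _; exact: third_point. Qed.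

Let U1 : U id. Proof. by case: HU. Qed.

Let Uc f g : U f -> U g -> U (f \o g). Proof. by case: HU => _ H _; exact: H. Qed.

Let Us a b : U (swap a b). Proof. exact: monoid_swap. Qed.

Lemma fExU_Alg V (phi : formula L_Alg (option V)) e :
  sat (Alg C) (fExU fCmp phi) e <-> exists2 s, U s & sat (Alg C) phi (assign e (fn s)).
Proof. exact: sat_fExU HU univ_Alg_fn fCmp_spec _ _ _. Qed.

Lemma fAllU_Alg V (phi : formula L_Alg (option V)) e :
  sat (Alg C) (fAllU fCmp phi) e <-> forall s, U s -> sat (Alg C) phi (assign e (fn s)).
Proof. exact: sat_fAllU HU univ_Alg_fn fCmp_spec _ _ _. Qed.

Lemma sat_fCmp W (e : W -> ambient A) x y z s t : U s -> U t ->
  e x = fn s -> e y = fn t -> sat (Alg C) (fCmp x y z) e <-> e z = fn (s \o t).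
Proof. by move=> Us' Ut xE yE; exact: (sat_cmp_fn fCmp_spec z Us' Ut xE yE). Qed.

Lemma sat_fId W (e : W -> ambient A) x s : U s -> e x = fn s ->
  sat (Alg C) (fId x) e <-> s = id.
Proof.
move=> Us' xE; rewrite fAllU_Alg; split=> [H|sE t Ut].
  by have := H id U1; rewrite (sat_fCmp _ Us' U1) // => /fn_inj /esym.
by rewrite (sat_fCmp _ Us' Ut) //= sE.
Qed.

Lemma sat_fInv W (e : W -> ambient A) x g : U g -> e x = fn g ->
  sat (Alg C) (fInv x) e <-> invertible U g.
Proof.
move=> Ug xE; split=> [/fExU_Alg[h Uh /fExU_Alg[i Ui]]|[_ [h Uh [gh hg]]]].
  move=> /sat_fAnd[] /sat_fId -/(_ _ Ui erefl) iE /sat_fAnd[].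
  rewrite (sat_fCmp _ Ug Uh) // (sat_fCmp _ Uh Ug) //= iE => /fn_inj gh /fn_inj hg.
  by split=> //; exists h.
apply/fExU_Alg; exists h => //; apply/fExU_Alg; exists id => //.
rewrite !sat_fAnd (sat_fId U1) // (sat_fCmp _ Ug Uh) // (sat_fCmp _ Uh Ug) //=.
by rewrite gh hg.
Qed.

Lemma sat_fConjugate W (e : W -> ambient A) x y t u : U t -> U u ->
  e x = fn t -> e y = fn u ->
  sat (Alg C) (fConjugate x y) e <-> conjugate U t u.
Proof.
move=> Ut Uu xE yE; split=> [/fExU_Alg[g Ug] /sat_fAnd[]|[_ [g [Ug Ig] E]]].
  rewrite (sat_fInv Ug) // => Ig /fExU_Alg[h Uh] /sat_fAnd[].
  rewrite (sat_fCmp _ Uu Ug) // (sat_fCmp _ Ug Ut) //= => -> /fn_inj E.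
  by split=> //; exists g.
apply/fExU_Alg; exists g => //; apply/sat_fAnd; rewrite (sat_fInv Ug) //.
split=> //; apply/fExU_Alg; exists (u \o g); first exact: Uc.
by apply/sat_fAnd; rewrite (sat_fCmp _ Uu Ug) // (sat_fCmp _ Ug Ut) //= E.
Qed.

Lemma sat_fCommute W (e : W -> ambient A) x y s t : U s -> U t ->
  e x = fn s -> e y = fn t ->
  sat (Alg C) (fCommute x y) e <-> s \o t = t \o s.
Proof.
move=> Us' Ut xE yE; split=> [/fExU_Alg[h Uh] /sat_fAnd[]|E].
  by rewrite (sat_fCmp _ Us' Ut) // (sat_fCmp _ Ut Us') //= => -> /fn_inj.
apply/fExU_Alg; exists (s \o t); first exact: Uc.
by apply/sat_fAnd; rewrite (sat_fCmp _ Us' Ut) // (sat_fCmp _ Ut Us') //= E.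
Qed.

Lemma sat_fInvol W (e : W -> ambient A) x t : U t -> e x = fn t ->
  sat (Alg C) (fInvol x) e <-> t \o t = id.
Proof.
move=> Ut xE; split=> [/fExU_Alg[i Ui] /sat_fAnd[]|E].
  by rewrite (sat_fId Ui) // (sat_fCmp _ Ut Ut) //= => -> /fn_inj.
apply/fExU_Alg; exists id => //; apply/sat_fAnd.
by rewrite (sat_fId U1) // (sat_fCmp _ Ut Ut) //= E.
Qed.

Lemma sat_fDvd6 W (e : W -> ambient A) x z : U z -> e x = fn z ->
  sat (Alg C) (fDvd6 x) e <-> order_dvd6 z.
Proof.
move=> Uz xE; split=> [/fExU_Alg[z2 Uz2] /sat_fAnd[]|E].
  rewrite (sat_fCmp _ Uz Uz) //= => /fn_inj z2E /fExU_Alg[z3 Uz3] /sat_fAnd[].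
  rewrite (sat_fCmp _ Uz2 Uz) //= => /fn_inj z3E.
  by rewrite (sat_fInvol Uz3) // z3E z2E.
have Uz2 := Uc Uz Uz; have Uz3 := Uc Uz2 Uz.
apply/fExU_Alg; exists (z \o z) => //; apply/sat_fAnd.
split; first by rewrite (sat_fCmp _ Uz Uz).
apply/fExU_Alg; exists (z \o z \o z) => //; apply/sat_fAnd.
by split; [rewrite (sat_fCmp _ Uz2 Uz)|rewrite (sat_fInvol Uz3)].
Qed.

Lemma sat_fTransposition W (e : W -> ambient A) x :
  sat (Alg C) (fTransposition x) e <-> exists a b, a <> b /\ e x = fn (swap a b).
Proof.
have not6 : forall s : seq {classic A}, uniq s -> size s = 6 -> exists r, r \notin s.
  by case: KC => _ _ _; exact: outside_six.
have H t : U t -> e x = fn t ->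
    sat (Alg C) (fTransposition x) e <-> transpositional U t.
  move=> Ut xE; rewrite /fTransposition !sat_fAnd sat_fNot (sat_fId Ut) // (sat_fInvol Ut) //.
  rewrite fExU_Alg fAllU_Alg; split.
    move=> [_ [Nid [tt [[u Uu /sat_fAnd[cu Nc]] all]]]].
    split=> //.
      exists u; first by move: cu; rewrite (sat_fConjugate Ut Uu).
      by move: Nc; rewrite sat_fNot (sat_fCommute Ut Uu).
    move=> u' cu'; have Uu' : U u' by case: cu'.
    have /sat_fImp := all u' Uu'; rewrite (sat_fConjugate Ut Uu') // => /(_ cu').
    move=> /fExU_Alg[z Uz /sat_fAnd[]]; rewrite (sat_fCmp _ Ut Uu') //= => /fn_inj <-.
    by rewrite (sat_fDvd6 Uz).
  move=> [_ tid tt [u cu Nc] t6].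
  have Uu : U u by case: cu.
  split; first by apply/(sat_fUn HU univ_Alg_fn fCmp_spec); exists t.
  do 2!split=> //; split.
    exists u => //; apply/sat_fAnd; rewrite sat_fNot.
    by rewrite (sat_fConjugate Ut Uu) // (sat_fCommute Ut Uu).
  move=> u' Uu'; apply/sat_fImp; rewrite (sat_fConjugate Ut Uu') // => cu'.
  have Uz := Uc Ut Uu'; apply/fExU_Alg; exists (t \o u') => //; apply/sat_fAnd.
  by rewrite (sat_fCmp _ Ut Uu') // (sat_fDvd6 Uz) //; split=> //; exact: t6.
split=> [sx|[a [b [ab xE]]]]; last first.
  by apply/(H _ _ xE) => //; apply/(transpositionalP HU third) => //; exists a, b.
have [t Ut xE] : exists2 t, U t & e x = fn t.
  by case: sx => /(sat_fUn HU univ_Alg_fn fCmp_spec).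
have /(transpositionalP HU third t not6) [a [b [ab tE]]] : transpositional U t.
  by apply/(H t Ut xE).
by exists a, b; rewrite -tE.
Qed.

Lemma sat_fMoves W (e : W -> ambient A) r s t p a b :
  p <> a -> p <> b -> a <> b -> e s = fn (swap p a) -> e t = fn (swap p b) ->
  sat (Alg C) (fMoves r s t) e <-> exists c, p <> c /\ e r = fn (swap p c).
Proof.
move=> pa pb ab sE tE.
have main c d : c <> d -> e r = fn (swap c d) ->
    sat (Alg C) (fMoves r s t) e <-> p = c \/ p = d.
  move=> cd rE; rewrite -(swap_moves pa pb ab cd).
  have -> : sat (Alg C) (fMoves r s t) e <->
    sat (Alg C) (fTransposition r) e /\ (e r = e s \/ e r = e t \/
      (~ sat (Alg C) (fCommute r s) e /\ ~ sat (Alg C) (fCommute r t) e /\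
       ~ sat (Alg C) (fExU fCmp (fAnd (fCmp (Some r) (Some s) None)
           (fCmp (Some s) (Some t) None))) e)) by [].
  rewrite (sat_fCommute (Us c d) (Us p a)) // (sat_fCommute (Us c d) (Us p b)) //.
  rewrite sat_fTransposition rE sE tE.
  have -> : sat (Alg C) (fExU fCmp (fAnd (fCmp (Some r) (Some s) None)
      (fCmp (Some s) (Some t) None))) e <->
      swap c d \o swap p a = swap p a \o swap p b.
    rewrite fExU_Alg; split=> [[z Uz /sat_fAnd[]]|E].
      rewrite (sat_fCmp _ (Us c d) (Us p a)) // (sat_fCmp _ (Us p a) (Us p b)) //=.
      by move=> -> /fn_inj.
    exists (swap c d \o swap p a); first exact: Uc.
    apply/sat_fAnd.
    by rewrite (sat_fCmp _ (Us c d) (Us p a)) // (sat_fCmp _ (Us p a) (Us p b)) //= E.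
  split=> [[_ []]|H].
  - by move=> /fn_inj ->; left.
  - by move=> [/fn_inj ->|[? []]]; right; [left|right].
  split; first by exists c, d.
  by case: H => [->|[->|[]]]; [left|right; left|right; right].
split=> [sr|[c [pc rE]]]; last by apply/(main p c pc rE); left.
have [c [d [cd rE]]] : exists c d, c <> d /\ e r = fn (swap c d).
  by apply/sat_fTransposition; case: sr.
have [E|E] : p = c \/ p = d by apply/(main c d cd rE).
  by subst c; exists d.
by subst d; exists c; split; [exact: nesym|rewrite swap_sym].
Qed.

Lemma sat_fPointCode W (e : W -> ambient A) s t :
  sat (Alg C) (fPointCode s t) e <-> exists p a b,
    [/\ p <> a, p <> b & a <> b] /\ e s = fn (swap p a) /\ e t = fn (swap p b).
Proof.
split=> [/sat_fAnd[/sat_fTransposition[a [b [ab sE]]]]|].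
  move=> /sat_fAnd[/sat_fTransposition[c [d [cd tE]]] /sat_fNot].
  rewrite (sat_fCommute (Us a b) (Us c d)) // => N.
  case: (pselect (a = c)) => [E|ac].
    subst c; exists a, b, d; split=> //; split=> // bd.
    by apply: N; rewrite bd.
  case: (pselect (a = d)) => [E|ad].
    subst d; exists a, b, c; rewrite [swap a c]swap_sym; split=> //; split=> // bc.
    by apply: N; rewrite bc swap_sym.
  case: (pselect (b = c)) => [E|bc].
    subst c; exists b, a, d; rewrite [swap b a]swap_sym; split=> //; split=> //.
    exact: nesym.
  case: (pselect (b = d)) => [E|bd].
    subst d; exists b, a, c; rewrite [swap b a]swap_sym [swap b c]swap_sym.
    by split=> //; split=> //; exact: nesym.
  by case: N; exact: swap_comm_disjoint.
move=> [p [a [b [[pa pb ab] [sE tE]]]]].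
apply/sat_fAnd; split; first by apply/sat_fTransposition; exists p, a.
apply/sat_fAnd; split; first by apply/sat_fTransposition; exists p, b.
apply/sat_fNot.
by rewrite (sat_fCommute (Us p a) (Us p b)) //; exact: swap_comm_meet.
Qed.

End Satisfaction.

(** * The structure of unary composition and points *)

(* Mid(C) has universe C + A; [MCmp n] composes an operation with unary ones, and
   [MMoves] relates a transposition to the points it moves. It is interpreted in
   Alg(C) by [tr], and Act(C) is defined in it by [mApp]. *)
Inductive Mid_symbol := MCmp (n : nat) | MMoves.

Definition L_Mid : language :=
  Language (fun s : Mid_symbol => if s is MCmp n then n.+3 else 2).

Definition pair2 (V : Type) (x y : V) (i : 'I_2) : V := if i == ord0 then x else y.

Lemma ord2P (P : 'I_2 -> Prop) : P ord0 -> P ord_max -> forall i, P i.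
Proof.
by move=> P0 P1 [[|[|//]] i2]; [move: P0|move: P1]; congr P; exact/val_inj.
Qed.

Section MidStructure.
Context (A : Type) (C : clone A).

(** Membership of [swap p c] in the clone is demanded so that the relation stays inside the universe
    for every clone, fully-transpositional or not. *)
Definition moves_rel : set ('I_2 -> ambient A) :=
  [set v | exists p c, [/\ p <> c, unaries C (swap p c),
     v ord0 = fn (swap p c) & v ord_max = pt p]].

Definition Mid_interp (P : L_Mid) : set ('I_(arity P) -> ambient A) :=
  match P return set ('I_(@arity L_Mid P) -> ambient A) with
  | MCmp n => @Cmp_rel A C n 0
  | MMoves => moves_rel
  end.

Lemma Mid_interp_univ (P : L_Mid) (v : 'I_(arity P) -> ambient A) :
  Mid_interp v -> forall i, Act_univ C (v i).
Proof.
case: P v => [n|] v /=.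
  by move=> /(Alg_interp_univ (P := Cmp n 0)) H i; move: (H i) => /=; case: (v i).
by move=> [p [c [_ Upc v0 v1]]]; apply: ord2P; rewrite ?v0 ?v1.
Qed.

Definition Mid : structure L_Mid (ambient A) := Structure Mid_interp_univ.

(* An operation f is coded by (f, f), a point p by two distinct transpositions
   moving p. *)
Definition code (c : 'I_2 -> ambient A) (b : ambient A) : Prop :=
  match b with
  | inl f => clone_set C f /\ c ord0 = inl f /\ c ord_max = inl f
  | inr p => exists x y, [/\ p <> x, p <> y & x <> y] /\
      c ord0 = fn (swap p x) /\ c ord_max = fn (swap p y)
  end.

Lemma code_univ c b : code c b -> Act_univ C b.
Proof. by case: b => // f []. Qed.

(** The two transpositions coding [p] send [p] to the distinct points [x] and [y]; hence equality of
    the components tells operations from points. *)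
Lemma code_eq c b : code c b -> c ord0 = c ord_max <-> exists f, b = inl f.
Proof.
case: b => [f [_ [-> ->]]|p [x [y [[px py xy] [-> ->]]]]]; first by split=> // _; exists f.
split=> [/fn_inj /(congr1 (fun g => g p))|[]//].
by rewrite !swapL.
Qed.

End MidStructure.

(** * Translation of formulas over Mid(C) into formulas over Alg(C) *)

Section Translation.

Definition fIsFn (V : Type) (x : V) : formula L_Alg (V * 'I_2) :=
  fEq _ (x, ord0) (x, ord_max).

Definition fCode (V : Type) (s t : V) : formula L_Alg V := fOr (fEq _ s t) (fPointCode s t).

Definition fMovesCode (V : Type) (r : V * 'I_2) (x : V) : formula L_Alg (V * 'I_2) :=
  fMoves r (x, ord0) (x, ord_max).

(** One quantifier becomes two nested ones: the outer variable [Some None] is component 0 of the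
    code, the inner variable [None] is component 1. *)
Definition bind_pair (V : Type) (x : option V * 'I_2) : option (option (V * 'I_2)) :=
  if x.1 is Some v then Some (Some (v, x.2))
  else if x.2 == ord0 then Some None else None.

(* Each variable of a formula over Mid(C) becomes a pair of variables; the first
   component of the code of a point is an operation, hence the tests [fIsFn]. *)
Definition tr_rel (V : Type) (P : L_Mid) : ('I_(arity P) -> V) -> formula L_Alg (V * 'I_2) :=
  match P return ('I_(@arity L_Mid P) -> V) -> formula L_Alg (V * 'I_2) with
  | MCmp n => fun v => fConj (fun j => fIsFn (v j))
      (@fRel L_Alg _ (Cmp n 0) (fun j => (v j, ord0)))
  | MMoves => fun v => fAnd (fIsFn (v ord0)) (fAnd (fNot (fIsFn (v ord_max)))
      (fMovesCode (v ord0, ord0) (v ord_max)))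
  end.

(** A point has several codes, so equality of points is not equality of codes: both transpositions
    coding the first point must move the second. Quantifiers are restricted to codes. *)
Fixpoint tr (V : Type) (phi : formula L_Mid V) : formula L_Alg (V * 'I_2) :=
  match phi with
  | fEq x y => fOr
      (fAnd (fIsFn x) (fAnd (fIsFn y) (fEq _ (x, ord0) (y, ord0))))
      (fAnd (fNot (fIsFn x)) (fAnd (fNot (fIsFn y))
        (fAnd (fMovesCode (x, ord0) y) (fMovesCode (x, ord_max) y))))
  | fRel P v => tr_rel v
  | fNot p => fNot (tr p)
  | fAnd p q => fAnd (tr p) (tr q)
  | fOr p q => fOr (tr p) (tr q)
  | fImp p q => fImp (tr p) (tr q)
  | fAll p => fAll (fAll (fImp (fCode (Some None) None) (rename (tr p) (@bind_pair _))))
  | fEx p => fEx (fEx (fAnd (fCode (Some None) None) (rename (tr p) (@bind_pair _))))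
  end.

Context (A : Type) (C : clone A) (KC : K_FTcln C).

Let FT : fully_transpositional C. Proof. by case: KC. Qed.

Let Us a b : unaries C (swap a b).
Proof. exact: (monoid_swap (unaries_monoid FT) a b). Qed.

Let third (a b : A) : exists2 c, c <> a & c <> b.
Proof. by case: KC => _ N1 N2 _; exact: third_point. Qed.

Lemma code_univ_Alg c b : code C c b -> forall i, Alg_univ C (c i).
Proof.
case: b => [f [Cf [c0 c1]]|p [x [y [_ [c0 c1]]]]]; apply: ord2P; rewrite ?c0 ?c1 //;
  exact: Us.
Qed.

Lemma code_onto b : Act_univ C b -> exists c, code C c b.
Proof.
case: b => [f Cf|p _]; first by exists (fun=> inl f).
have [x xp _] := third p p; have [y yp yx] := third p x.
exists (pair2 (fn (swap p x)) (fn (swap p y))); exists x, y.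
by split=> //; split; exact: nesym.
Qed.

(** A point is recovered as the only common element of the two distinct pairs moved by its code. *)
Lemma code_fun c b b' : code C c b -> code C c b' -> b = b'.
Proof.
move=> cb cb'; case: (pselect (c ord0 = c ord_max)) => [E|N].
  have /(code_eq cb)[f bE] := E; have /(code_eq cb')[f' bE'] := E; subst b b'.
  by case: cb cb' => _ [<- _] [_ [<- _]].
case: b cb => [f cb|p [x [y [[px py xy] [c0 c1]]]]]; first by case: N; apply/(code_eq cb); exists f.
case: b' cb' => [f cb'|q [z [w [[qz qw zw] []]]]]; first by case: N; apply/(code_eq cb'); exists f.
rewrite c0 c1 => /fn_inj /(swap_pair px qz) E1 /fn_inj /(swap_pair py qw) E2.
by congr inr; case: E1 E2 => -[? ?] [] [? ?]; congruence.
Qed.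

Lemma sat_fCode V (e : V -> ambient A) s t : Alg_univ C (e s) ->
  sat (Alg C) (fCode s t) e <-> exists b, code C (pair2 (e s) (e t)) b.
Proof.
move=> sA; split=> [/sat_fOr[/sat_fEq E|/(sat_fPointCode KC)]|[b cb]].
- by case: (e s) sA E => // f Cf <-; exists (inl f).
- by move=> [p [x [y [xy [sE tE]]]]]; exists (inr p), x, y.
- apply/sat_fOr; case: b cb => [f [_ [c0 c1]]|p [x [y [xy [sE tE]]]]]; [left|right].
    exact: etrans c0 (esym c1).
  by apply/(sat_fPointCode KC); exists p, x, y.
Qed.

Lemma sat_fIsFn V (a : V -> 'I_2 -> ambient A) b x : code C (a x) b ->
  sat (Alg C) (fIsFn x) (fun p => a p.1 p.2) <-> exists f, b = inl f.
Proof. by move=> /code_eq <-. Qed.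

Lemma sat_fMovesCode V (a : V -> 'I_2 -> ambient A) r p x : code C (a x) (inr p) ->
  sat (Alg C) (fMovesCode r x) (fun p => a p.1 p.2) <->
  exists c, p <> c /\ a r.1 r.2 = fn (swap p c).
Proof.
by move=> [y [z [[py pz yz] [x0 x1]]]]; apply: (sat_fMoves KC _ py pz yz).
Qed.

(** Induction on [phi]. The quantifier cases use that every element of Mid(C) has a code and that
    every pair satisfying [fCode] is the code of an element. *)
Lemma sat_tr V (phi : formula L_Mid V) (a : V -> 'I_2 -> ambient A) b :
  (forall v, code C (a v) (b v)) ->
  sat (Alg C) (tr phi) (fun p => a p.1 p.2) <-> sat (Mid C) phi b.
Proof.
have bindE W (a' : W -> 'I_2 -> ambient A) u v :
    assign (assign (fun p => a' p.1 p.2) u) v \o @bind_pair W =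
    fun p => (if p.1 is Some w then a' w else pair2 u v) p.2.
  by apply/funext => -[[w|] i] //=; rewrite /bind_pair /pair2 /=; case: ifP.
have bind_code W (a' : W -> 'I_2 -> ambient A) b' u v d :
    (forall w, code C (a' w) (b' w)) -> code C (pair2 u v) d ->
    forall w, code C (if w is Some w' then a' w' else pair2 u v) (assign b' d w).
  by move=> ab ud [].
have pairE (c : 'I_2 -> ambient A) : c = pair2 (c ord0) (c ord_max).
  by apply/funext; exact: ord2P.
elim: phi a b => {V}.
- move=> V x y a b ab; rewrite sat_fEq.
  have -> : sat (Alg C) (tr (fEq L_Mid x y)) (fun p => a p.1 p.2) <->
    (sat (Alg C) (fIsFn x) (fun p => a p.1 p.2) /\
     sat (Alg C) (fIsFn y) (fun p => a p.1 p.2) /\ a x ord0 = a y ord0) \/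
    (~ sat (Alg C) (fIsFn x) (fun p => a p.1 p.2) /\
     ~ sat (Alg C) (fIsFn y) (fun p => a p.1 p.2) /\
     sat (Alg C) (fMovesCode (x, ord0) y) (fun p => a p.1 p.2) /\
     sat (Alg C) (fMovesCode (x, ord_max) y) (fun p => a p.1 p.2)) by [].
  rewrite !(sat_fIsFn (ab _)).
  have := ab x; have := ab y; case bx: (b x) => [f|p]; case bY: (b y) => [g|q].
  + move=> [_ [-> _]] [_ [-> _]]; split=> [[[_ [_ ->]]//|[[]]]|->]; first by exists f.
    by left; split; [exists g|split; [exists g|]].
  + by move=> _ _; split=> // -[[_ [[]//]]|[[]]]; exists f.
  + by move=> _ _; split=> // -[[[]//]|[_ [[]]]]; exists g.
  move=> cy cx; rewrite !(sat_fMovesCode _ cy) /=.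
  have := cx => -[x' [y' [[px py xy] [-> ->]]]].
  split=> [[[[]//]|[_ [_ [[c [qc E1]] [d [qd E2]]]]]]|[<-]].
    move: E1 E2 => /fn_inj /(swap_pair px qc) E1 /fn_inj /(swap_pair py qd) E2.
    by congr inr; case: E1 E2 => -[? ?] [] [? ?]; congruence.
  by right; split=> [[]//|]; split=> [[]//|]; split; [exists x'|exists y'].
- move=> V [n|] v a b ab.
    rewrite [tr _]/= sat_fConj; split=> [[fnv H]|H].
      have -> // : sat (Mid C) (@fRel L_Mid _ (MCmp n) v) b = @Cmp_rel A C n 0 (fun j => a (v j) ord0).
      congr (@Cmp_rel A C n 0 _); apply/funext => j.
      have /(sat_fIsFn (ab _))[f bE] := fnv j.
      by have := ab (v j); rewrite bE => -[_ [-> _]].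
    (* Composition holds only between operations, so each argument is an operation and both
       components of its code equal it. *)
    have bF j : exists f, b (v j) = inl f.
      have := @Alg_interp_univ A C (Cmp n 0) _ H j => /=.
      by case: (b (v j)) => // f _; exists f.
    split=> [j|]; first exact/(sat_fIsFn (ab _)).
    have -> // : sat (Alg C) (@fRel L_Alg _ (Cmp n 0) (fun j => (v j, ord0)))
        (fun p => a p.1 p.2) = @Cmp_rel A C n 0 (fun j => b (v j)).
    congr (@Cmp_rel A C n 0 _); apply/funext => j /=.
    by have [f bE] := bF j; have := ab (v j); rewrite bE => -[_ [-> _]].
  have -> : sat (Alg C) (tr (@fRel L_Mid _ MMoves v)) (fun p => a p.1 p.2) <->
    sat (Alg C) (fIsFn (v ord0)) (fun p => a p.1 p.2) /\
    ~ sat (Alg C) (fIsFn (v ord_max)) (fun p => a p.1 p.2) /\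
    sat (Alg C) (fMovesCode (v ord0, ord0) (v ord_max)) (fun p => a p.1 p.2) by [].
  rewrite !(sat_fIsFn (ab _)).
  have -> : sat (Mid C) (@fRel L_Mid _ MMoves v) b = moves_rel C (fun j => b (v j)) by [].
  have := ab (v ord0); have := ab (v ord_max).
  rewrite /moves_rel /=.
  case b0: (b (v ord0)) => [f|p]; case b1: (b (v ord_max)) => [g|q].
  + by move=> _ _; split=> [[_ [[]]]|[? [? []]]//]; exists g.
  + move=> c1 [_ [fE _]]; rewrite (sat_fMovesCode _ c1) /= fE.
    split=> [[_ [_ [c [qc E]]]]|[p [c [pc _ E [->]]]]]; first by exists q, c; split.
    by split; [exists f|split; [case|exists c]].
  + by move=> _ _; split=> [[[]//]|[? [? []]]//].
  + by move=> _ _; split=> [[[]//]|[? [? []]]//].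
- by move=> V p IH a b ab; rewrite /= !sat_fNot (IH a b).
- by move=> V p IHp q IHq a b ab; rewrite /= !sat_fAnd (IHp a b) // (IHq a b).
- by move=> V p IHp q IHq a b ab; rewrite /= !sat_fOr (IHp a b) // (IHq a b).
- by move=> V p IHp q IHq a b ab; rewrite /= !sat_fImp (IHp a b) // (IHq a b).
- move=> V p IH a b ab /=; split=> [H d Cd|H]; last apply/sat_fAll => u Cu.
    have [c cd] := code_onto Cd; have cA := code_univ_Alg cd.
    move: cd; rewrite (pairE c) => cd.
    move: H => /sat_fAll /(_ _ (cA ord0)) /sat_fAll /(_ _ (cA ord_max)) /sat_fImp.
    rewrite sat_rename bindE (IH _ _ (bind_code _ _ _ _ _ _ ab cd)); apply.
    by apply/sat_fCode; [exact: cA|exists d].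
  apply/sat_fAll => v Cv; apply/sat_fImp => /(sat_fCode (e := assign (assign _ u) v)) -/(_ Cu) [d cd].
  rewrite sat_rename bindE (IH _ _ (bind_code _ _ _ _ _ _ ab cd)).
  by apply: H; exact: code_univ cd.
- move=> V p IH a b ab /=; split=> [/sat_fEx[u Cu /sat_fEx[v Cv /sat_fAnd[]]]|/sat_fEx[d Cd H]].
    move=> /(sat_fCode (e := assign (assign _ u) v)) -/(_ Cu) [d cd].
    rewrite sat_rename bindE (IH _ _ (bind_code _ _ _ _ _ _ ab cd)) => H.
    by apply/sat_fEx; exists d => //; exact: code_univ cd.
  have [c cd] := code_onto Cd; have cA := code_univ_Alg cd.
  move: cd; rewrite (pairE c) => cd.
  apply/sat_fEx; exists (c ord0); first exact: cA.
  apply/sat_fEx; exists (c ord_max); first exact: cA.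
  apply/sat_fAnd; split; first by apply/sat_fCode; [exact: cA|exists d].
  by rewrite sat_rename bindE (IH _ _ (bind_code _ _ _ _ _ _ ab cd)).
Qed.

End Translation.

(** * Application defined in Mid(C) *)

Definition mCmp (V : Type) (x y z : V) : formula L_Mid V :=
  @fRel L_Mid V (MCmp 0) (places x (fun=> y) z).

Definition mMoves (V : Type) (r x : V) : formula L_Mid V :=
  @fRel L_Mid V MMoves (pair2 r x).

(** Points are the elements moved by some transposition. *)
Definition mPt (V : Type) (x : V) : formula L_Mid V := fEx (mMoves None (Some x)).

Definition mExP (V : Type) (phi : formula L_Mid (option V)) : formula L_Mid V :=
  fEx (fAnd (mPt None) phi).

Definition mAllP (V : Type) (phi : formula L_Mid (option V)) : formula L_Mid V :=
  fAll (fImp (mPt None) phi).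

Definition mExU (V : Type) := @fExU L_Mid mCmp V.

Definition mAllU (V : Type) := @fAllU L_Mid mCmp V.

Definition mNeq (V : Type) (x y : V) : formula L_Mid V := fNot (fEq _ x y).

Definition mSwap (V : Type) (r x y : V) : formula L_Mid V :=
  fAnd (mMoves r x) (fAnd (mMoves r y) (mNeq x y)).

(* For p <> q, k o (p q) = k means k p = k q. *)
Definition mKer (V : Type) (k p q : V) : formula L_Mid V :=
  fOr (fEq _ p q) (mExU (fAnd (mSwap None (Some p) (Some q)) (mCmp (Some k) None (Some k)))).

Definition mConst (V : Type) (z : V) : formula L_Mid V :=
  mAllP (mAllP (mKer (Some (Some z)) (Some None) None)).

Definition mConstAt (V : Type) (z b : V) : formula L_Mid V :=
  fAnd (mConst z) (mAllP (fImp (mNeq None (Some b))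
    (mExU (fAnd (mSwap None (Some (Some b)) (Some None))
                (fNot (mCmp None (Some (Some z)) (Some (Some z)))))))).

Definition mInj (V : Type) (h : V) : formula L_Mid V :=
  mAllP (mAllP (fImp (mKer (Some (Some h)) (Some None) None) (fEq _ (Some None) None))).

Definition mHasConst (V : Type) : formula L_Mid V := mExU (mConst None).

Definition mEvalConst (V : Type) (h x b : V) : formula L_Mid V :=
  mExU (fAnd (mConstAt None (Some x)) (mExU
    (fAnd (mConstAt None (Some (Some b))) (mCmp (Some (Some h)) (Some None) None)))).

Definition mEvalInj (V : Type) (h x b : V) : formula L_Mid V :=
  fAnd (mInj h) (mAllP (fImp (mNeq None (Some x))
    (mExP (fAnd (mNeq None (Some (Some b)))
      (mExU (fAnd (mSwap None (Some (Some (Some x))) (Some (Some None)))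
        (mExU (fAnd (mSwap None (Some (Some (Some (Some b)))) (Some (Some None)))
          (mExU (fAnd (mCmp (Some (Some (Some (Some (Some h))))) (Some (Some None)) None)
             (mCmp (Some None) (Some (Some (Some (Some (Some h))))) None))))))))))).

Definition mEvalNoninj (V : Type) (h x b : V) : formula L_Mid V :=
  fAnd (fNot (mInj h)) (mAllP (fImp (fNot (mKer (Some h) (Some x) None))
    (mExP (fAnd (mNeq None (Some (Some b)))
      (mAllU (mExU (fAnd (mCmp (Some None) (Some (Some (Some (Some h)))) None)
        (fAnd (fImp (mKer None (Some (Some (Some (Some x)))) (Some (Some (Some None))))
                    (mKer (Some None) (Some (Some (Some (Some b)))) (Some (Some None))))
              (fImp (mKer (Some None) (Some (Some (Some (Some b)))) (Some (Some None)))
                    (mKer None (Some (Some (Some (Some x)))) (Some (Some (Some None))))))))))))).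

Definition mEval (V : Type) (h x b : V) : formula L_Mid V :=
  fOr (mEvalConst h x b)
    (fAnd (fNot (mHasConst V)) (fOr (mEvalInj h x b) (mEvalNoninj h x b))).

(** The formula asks for a point [x] and unary operations g_i with g_i x = a_i such that [h], the
    composition of f with the g_i, satisfies h x = b. The tests [mPt] accompany [mEval] because its
    meaning is established for points only. *)
Definition mApp (n : nat) : formula L_Mid 'I_n.+3 :=
  let old (j : 'I_n.+3) : option (option 'I_n.+3) + 'I_n.+1 := inl (Some (Some j)) in
  let x := inl (Some None) in
  let h := inl None in
  mExP (mExU (fExs (fAnd
    (fConj (fun i => fAnd (mPt (old (mid_place i))) (mEval (inr i) x (old (mid_place i))))
      (@fRel L_Mid _ (MCmp n) (places (old (fst_place n)) inr h)))
    (fAnd (mPt (old (lst_place n))) (mEval h x (old (lst_place n))))))).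

(** * Meaning of the formulas over Mid(C), up to application *)

Section MidSatisfaction.
Context (A : Type) (C : clone A) (KC : K_FTcln C).
Local Notation U := (unaries C).
Local Notation satM := (sat (Mid C)).

Let HU : transposition_monoid U.
Proof. by case: KC => FT _ _ _; exact: unaries_monoid. Qed.

Let third (a b : A) : exists2 c, c <> a & c <> b.
Proof. by case: KC => _ N1 N2 _; exact: third_point. Qed.

Let Uc (f g : A -> A) : U f -> U g -> U (f \o g). Proof. by case: HU => _ H _; exact: H. Qed.

Let Us (a b : A) : U (swap a b). Proof. exact: monoid_swap. Qed.

Lemma univ_Mid_fn s : U s -> univ (Mid C) (fn s).
Proof. by []. Qed.

Lemma mCmp_spec : cmp_spec mCmp C (Mid C).
Proof.
move=> V e x y z; rewrite -Cmp_rel_unaryP.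
by rewrite -[places (e x) _ _]/(places (e x) (e \o fun=> y) (e z)) -map_places.
Qed.

Lemma sat_mExU W (phi : formula L_Mid (option W)) (e : W -> ambient A) :
  satM (mExU phi) e <-> exists2 s, U s & satM phi (assign e (fn s)).
Proof. exact: sat_fExU HU univ_Mid_fn mCmp_spec _ _ _. Qed.

Lemma sat_mAllU W (phi : formula L_Mid (option W)) (e : W -> ambient A) :
  satM (mAllU phi) e <-> forall s, U s -> satM phi (assign e (fn s)).
Proof. exact: sat_fAllU HU univ_Mid_fn mCmp_spec _ _ _. Qed.

Lemma sat_mCmp W (e : W -> ambient A) x y z s t : U s -> U t ->
  e x = fn s -> e y = fn t -> satM (mCmp x y z) e <-> e z = fn (s \o t).
Proof. by move=> Us' Ut xE yE; exact: (sat_cmp_fn mCmp_spec z Us' Ut xE yE). Qed.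

Lemma sat_mMoves W (e : W -> ambient A) r x :
  satM (mMoves r x) e <-> exists p c, [/\ p <> c, e r = fn (swap p c) & e x = pt p].
Proof.
have -> : satM (mMoves r x) e = moves_rel C (fun i => e (pair2 r x i)) by [].
by split=> [[p [c []]]|[p [c []]]]; exists p, c.
Qed.

Lemma sat_mPt W (e : W -> ambient A) x : satM (mPt x) e <-> exists p, e x = pt p.
Proof.
split=> [/sat_fEx[r _ /sat_mMoves[p [c [_ _ xE]]]]|[p xE]]; first by exists p.
have [c cp _] := third p p; apply/sat_fEx; exists (fn (swap p c)); first exact: Us.
by apply/sat_mMoves; exists p, c; split=> //; exact: nesym.
Qed.

Lemma sat_mExP W (phi : formula L_Mid (option W)) (e : W -> ambient A) :
  satM (mExP phi) e <-> exists p, satM phi (assign e (pt p)).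
Proof.
split=> [/sat_fEx[b _ /sat_fAnd[/sat_mPt[p /= ->] H]]|[p H]]; first by exists p.
apply/sat_fEx; exists (pt p) => //; apply/sat_fAnd; split=> //.
by apply/sat_mPt; exists p.
Qed.

Lemma sat_mAllP W (phi : formula L_Mid (option W)) (e : W -> ambient A) :
  satM (mAllP phi) e <-> forall p, satM phi (assign e (pt p)).
Proof.
split=> [/sat_fAll H p|H]; last first.
  by apply/sat_fAll => b _; apply/sat_fImp => /sat_mPt[p /= ->].
by have /sat_fImp := H (pt p) I; apply; apply/sat_mPt; exists p.
Qed.

Lemma sat_mNeq W (e : W -> ambient A) x y p q : e x = pt p -> e y = pt q ->
  satM (mNeq x y) e <-> p <> q.
Proof.
move=> xE yE; rewrite sat_fNot sat_fEq xE yE.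
by split=> N E; apply: N; [rewrite E|case: E].
Qed.

Lemma sat_mSwap W (e : W -> ambient A) r x y p q : e x = pt p -> e y = pt q ->
  satM (mSwap r x y) e <-> p <> q /\ e r = fn (swap p q).
Proof.
move=> xE yE; split=> [/sat_fAnd[/sat_mMoves[p' [c [pc rE]]]]|[pq rE]].
  rewrite xE => -[?]; subst p'; move=> /sat_fAnd[/sat_mMoves[q' [d [qd]]]].
  rewrite yE rE => /fn_inj E [?]; subst q'; move=> /(sat_mNeq xE yE) pq.
  by case: (swap_pair pc qd E) => -[//= pE cE]; split=> //; congr fn; congr swap.
apply/sat_fAnd; split; first by apply/sat_mMoves; exists p, q.
apply/sat_fAnd; split; last exact/(sat_mNeq xE yE).
by apply/sat_mMoves; exists q, p; rewrite swap_sym; split=> //; exact: nesym.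
Qed.

Lemma sat_mKer W (e : W -> ambient A) k x y s p q : U s ->
  e k = fn s -> e x = pt p -> e y = pt q -> satM (mKer k x y) e <-> s p = s q.
Proof.
move=> Uk kE xE yE; split=> [/sat_fOr[/sat_fEq|/sat_mExU[r Ur /sat_fAnd[]]]|spq].
- by rewrite xE yE => -[->].
- rewrite (@sat_mSwap _ _ _ _ _ p q) // => -[_ /fn_inj ->].
  by rewrite (sat_mCmp _ Uk (Us p q)) //= kE => /fn_inj /esym /comp_swap_eq.
apply/sat_fOr; case: (pselect (p = q)) => [E|pq]; [left|right].
  by apply/sat_fEq; rewrite xE yE E.
apply/sat_mExU; exists (swap p q) => //; apply/sat_fAnd.
rewrite (@sat_mSwap _ _ _ _ _ p q) // (sat_mCmp _ Uk (Us p q)) //= kE.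
by split=> //; congr fn; apply/esym/comp_swap_eq.
Qed.

Lemma sat_mConst W (e : W -> ambient A) z Z : U Z -> e z = fn Z ->
  satM (mConst z) e <-> constant Z.
Proof.
move=> UZ zE; rewrite sat_mAllP; split=> [H p q|H p].
  by have /sat_mAllP /(_ q) := H p; rewrite (@sat_mKer _ _ _ _ _ Z p q).
by apply/sat_mAllP => q; rewrite (@sat_mKer _ _ _ _ _ Z p q).
Qed.

Lemma sat_mConstAt W (e : W -> ambient A) z x Z b : U Z -> e z = fn Z -> e x = pt b ->
  satM (mConstAt z x) e <-> constant_at Z b.
Proof.
move=> UZ zE xE; split=> [/sat_fAnd[/(sat_mConst UZ zE) ZC /sat_mAllP H]|[ZC H]].
  split=> // c cb; have /sat_fImp := H c; rewrite (@sat_mNeq _ _ _ _ c b) // => /(_ cb).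
  move=> /sat_mExU[r Ur /sat_fAnd[]]; rewrite (@sat_mSwap _ _ _ _ _ b c) // => -[_ /fn_inj ->].
  by rewrite sat_fNot (sat_mCmp _ (Us b c) UZ) //= zE => N E; apply: N; rewrite E.
apply/sat_fAnd; split; first exact/(sat_mConst UZ zE).
apply/sat_mAllP => c; apply/sat_fImp; rewrite (@sat_mNeq _ _ _ _ c b) // => cb.
apply/sat_mExU; exists (swap b c) => //; apply/sat_fAnd.
rewrite (@sat_mSwap _ _ _ _ _ b c) // sat_fNot (sat_mCmp _ (Us b c) UZ) //= zE.
by split; [split=> //; exact: nesym|move=> /fn_inj /esym; exact: H].
Qed.

Lemma sat_mInj W (e : W -> ambient A) z h : U h -> e z = fn h ->
  satM (mInj z) e <-> injective h.
Proof.
move=> Uh zE; rewrite sat_mAllP; split=> [H p q|H p].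
  have /sat_mAllP /(_ q) /sat_fImp := H p.
  by rewrite (@sat_mKer _ _ _ _ _ h p q) // sat_fEq /= => K /K [].
apply/sat_mAllP => q; apply/sat_fImp.
by rewrite (@sat_mKer _ _ _ _ _ h p q) // sat_fEq /= => /H ->.
Qed.

Lemma sat_mHasConst W (e : W -> ambient A) : satM (mHasConst W) e <-> has_constant U.
Proof.
rewrite sat_mExU; split=> -[Z UZ H]; exists Z => //; first by move: H; rewrite (sat_mConst UZ).
by rewrite (sat_mConst UZ).
Qed.

Section Evaluation.
Context (W : Type) (e : W -> ambient A) (vh vx vb : W) (h : A -> A) (x b : A).
Hypotheses (Uh : U h) (hE : e vh = fn h) (xE : e vx = pt x) (bE : e vb = pt b).

Lemma sat_mEvalConst : satM (mEvalConst vh vx vb) e <-> evaluates_const U h x b.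
Proof.
split=> [/sat_mExU[Zx UZx /sat_fAnd[]]|[Zx UZx [Zb UZb [cx cb E]]]].
  rewrite (@sat_mConstAt _ _ _ _ Zx x) // => cx /sat_mExU[Zb UZb /sat_fAnd[]].
  rewrite (@sat_mConstAt _ _ _ _ Zb b) // (sat_mCmp _ Uh UZx) //= => cb /fn_inj E.
  by exists Zx => //; exists Zb.
apply/sat_mExU; exists Zx => //; apply/sat_fAnd; rewrite (@sat_mConstAt _ _ _ _ Zx x) //.
split=> //; apply/sat_mExU; exists Zb => //; apply/sat_fAnd.
by rewrite (@sat_mConstAt _ _ _ _ Zb b) // (sat_mCmp _ Uh UZx) //= E.
Qed.

Lemma sat_mEvalInj : satM (mEvalInj vh vx vb) e <-> evaluates_inj h x b.
Proof.
split=> [/sat_fAnd[/(sat_mInj Uh hE) hi /sat_mAllP H]|[hi H]].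
  split=> // y yx; have /sat_fImp := H y; rewrite (@sat_mNeq _ _ _ _ y x) // => /(_ yx).
  move=> /sat_mExP[c /sat_fAnd[]]; rewrite (@sat_mNeq _ _ _ _ c b) // => cb.
  move=> /sat_mExU[r _ /sat_fAnd[]]; rewrite (@sat_mSwap _ _ _ _ _ x y) // => -[_ /fn_inj ->].
  move=> /sat_mExU[r' _ /sat_fAnd[]]; rewrite (@sat_mSwap _ _ _ _ _ b c) // => -[_ /fn_inj ->].
  move=> /sat_mExU[m _ /sat_fAnd[]].
  rewrite (sat_mCmp _ Uh (Us x y)) // (sat_mCmp _ (Us b c) Uh) //= => -> /fn_inj E.
  by exists c.
apply/sat_fAnd; split; first exact/(sat_mInj Uh hE).
apply/sat_mAllP => y; apply/sat_fImp; rewrite (@sat_mNeq _ _ _ _ y x) // => yx.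
have [c cb E] := H y yx; apply/sat_mExP; exists c; apply/sat_fAnd.
rewrite (@sat_mNeq _ _ _ _ c b) //; split=> //.
apply/sat_mExU; exists (swap x y) => //; apply/sat_fAnd.
rewrite (@sat_mSwap _ _ _ _ _ x y) //; split; first by split=> //; exact: nesym.
apply/sat_mExU; exists (swap b c) => //; apply/sat_fAnd.
rewrite (@sat_mSwap _ _ _ _ _ b c) //; split; first by split=> //; exact: nesym.
apply/sat_mExU; exists (h \o swap x y); first exact: Uc; apply/sat_fAnd.
by rewrite (sat_mCmp _ Uh (Us x y)) // (sat_mCmp _ (Us b c) Uh) //= E.
Qed.

Lemma sat_mEvalNoninj : satM (mEvalNoninj vh vx vb) e <-> evaluates_noninj U h x b.
Proof.
split=> [/sat_fAnd[/sat_fNot Nh /sat_mAllP H]|[Nh H]].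
  split=> [/(sat_mInj Uh hE)//|y hxy].
  have /sat_fImp := H y; rewrite sat_fNot (@sat_mKer _ _ _ _ _ h x y) // => /(_ hxy).
  move=> /sat_mExP[v /sat_fAnd[]]; rewrite (@sat_mNeq _ _ _ _ v b) // => nvb /sat_mAllU K.
  exists v => // k Uk; have /sat_mExU[m Um /sat_fAnd[]] := K k Uk.
  rewrite (sat_mCmp _ Uk Uh) //= => /fn_inj mE /sat_fAnd[/sat_fImp + /sat_fImp].
  by rewrite (@sat_mKer _ _ _ _ _ m x y) // (@sat_mKer _ _ _ _ _ k b v) // mE.
apply/sat_fAnd; split; first by apply/sat_fNot => /(sat_mInj Uh hE).
apply/sat_mAllP => y; apply/sat_fImp; rewrite sat_fNot (@sat_mKer _ _ _ _ _ h x y) // => hxy.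
have [v nvb K] := H y hxy; apply/sat_mExP; exists v; apply/sat_fAnd.
rewrite (@sat_mNeq _ _ _ _ v b) //; split=> //.
apply/sat_mAllU => k Uk; apply/sat_mExU; have Um := Uc Uk Uh; exists (k \o h) => //.
apply/sat_fAnd; rewrite (sat_mCmp _ Uk Uh) //; split=> //.
have [K1 K2] := K k Uk; apply/sat_fAnd; split; apply/sat_fImp;
by rewrite (@sat_mKer _ _ None _ _ (k \o h) x y) // (@sat_mKer _ _ (Some None) _ _ k b v).
Qed.

Lemma sat_mEval : satM (mEval vh vx vb) e <-> h x = b.
Proof.
rewrite -(evaluatesP HU third _ _ Uh) /evaluates.
rewrite -sat_mEvalConst -sat_mEvalInj -sat_mEvalNoninj -(sat_mHasConst e).
by [].
Qed.

End Evaluation.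

Lemma sat_mApp n (v : 'I_n.+3 -> ambient A) :
  satM (mApp n) v <-> @App_rel A C n v.
Proof.
split.
  move=> /sat_mExP[x /sat_mExU[h Uh /sat_fExs[g _ /sat_fAnd[/sat_fConj[H1 H2]]]]].
  move=> /sat_fAnd[/sat_mPt[b bE]]; rewrite (@sat_mEval _ _ _ _ _ h x b) // => hxb.
  have /Cmp_relP[f [G [[]]]] : @Cmp_rel A C n 0 _ := H2.
  rewrite places_fst places_lst => fE gE /fn_inj hE [Cf UG].
  have {}gE i : g i = fn (G i) by have := gE i; rewrite places_mid.
  exists f, (fun i => G i x), b; split; last by rewrite -hxb hE.
  split=> // i; have /sat_fAnd[/sat_mPt[a aE]] := H1 i.
  by have [Ui gi] := (UG i, gE i); rewrite (@sat_mEval _ _ _ _ _ (G i) x a) // => ->.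
move=> [f [a [b [[fE aE bE] [Cf fab]]]]].
(* The auxiliary point [x] is taken to be [b] itself, and [G i] sends it to [a i]. *)
pose G i := swap b (a i).
have Uh : U (fun y => f (fun i => G i y)).
  exact: (@clone_comp A C n 0 f (fun i y => G i (y ord0)) Cf (fun i => Us _ _)).
apply/sat_mExP; exists b; apply/sat_mExU; exists (fun y => f (fun i => G i y)) => //.
apply/sat_fExs; exists (fun i => fn (G i)) => [i|]; first exact: Us.
apply/sat_fAnd; split.
  apply/sat_fConj; split=> [i|].
    apply/sat_fAnd; split; first by apply/sat_mPt; exists (a i); exact: aE.
    apply/(@sat_mEval _ _ _ _ _ (G i) b (a i)) => //; [exact: Us|exact: aE|].
    exact: swapL.
  have // : @Cmp_rel A C n 0 (fun j => assigns
    (assign (assign v (pt b)) (fn (fun y => f (fun i => G i y)))) (fun i => fn (G i))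
    (places (inl (Some (Some (fst_place n)))) inr (inl None) j)).
  apply/Cmp_relP; exists f, G; split; last by split=> // i; exact: Us.
  by split=> [|i|]; rewrite places_simpl.
apply/sat_fAnd; split; first by apply/sat_mPt; exists b; exact: bE.
apply/(@sat_mEval _ _ _ _ _ (fun y => f (fun i => G i y)) b b) => //.
by rewrite -[RHS]fab; congr f; apply/funext => i; exact: swapL.
Qed.

End MidSatisfaction.

(** * Codes in Act(C) *)

Definition aApp (V : Type) (f x y : V) : formula L_Act V :=
  @fRel L_Act V (App 0) (places f (fun=> x) y).

Definition aPt (V : Type) (x : V) : formula L_Act V :=
  fEx (fEx (aApp (Some None) (Some (Some x)) None)).

Definition aSwap (V : Type) (s x y : V) : formula L_Act V :=
  fAnd (aApp s x y) (fAnd (aApp s y x) (fAnd (fNot (fEq _ x y))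
    (fAll (fImp (aPt None) (fOr (fEq _ None (Some x)) (fOr (fEq _ None (Some y))
      (aApp (Some s) None None))))))).

(** This defines the relation [code] inside Act(C), hence the graph of the interpretation map. In
    the first disjunct [fNot (aPt x)] keeps a point from being coded by itself twice. *)
Definition aCode (V : Type) (s t x : V) : formula L_Act V :=
  fOr (fAnd (fEq _ s t) (fAnd (fEq _ x s) (fNot (aPt x))))
    (fEx (fEx (fAnd (aSwap (Some (Some s)) (Some (Some x)) (Some None))
      (fAnd (aSwap (Some (Some t)) (Some (Some x)) None) (fNot (fEq _ (Some None) None)))))).

Section ActSatisfaction.
Context (A : Type) (C : clone A) (KC : K_FTcln C).
Local Notation U := (unaries C).
Local Notation satA := (sat (Act C)).

Let HU : transposition_monoid U.
Proof. by case: KC => FT _ _ _; exact: unaries_monoid. Qed.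

Lemma sat_aApp W (e : W -> ambient A) f x y :
  satA (aApp f x y) e <->
  exists s p, [/\ U s, e f = fn s, e x = pt p & e y = pt (s p)].
Proof.
have -> : satA (aApp f x y) e <-> @App_rel A C 0 (places (e f) (fun=> e x) (e y)).
  by rewrite -[places (e f) _ _]/(places (e f) (e \o fun=> x) (e y)) -map_places.
split=> [[g [a [b [[]]]]]|[s [p [Us fE xE yE]]]].
  rewrite places_fst places_lst => fE xE yE [Cg gab].
  have := xE ord0; rewrite places_mid => {}xE.
  have gE : Op g = unary (fun p => g (fun=> p)) by rewrite {1}[g]op_unary.
  exists (fun p => g (fun=> p)), (a ord0); split=> //.
  - by rewrite /unaries /= -gE.
  - by rewrite fE gE.
  - rewrite yE -gab; congr inr; congr g; apply/funext => i; by rewrite (ord1 i).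
exists (fun z => s (z ord0)), (fun=> p), (s p); split=> //.
by split=> [|i|]; rewrite places_simpl.
Qed.

Lemma sat_aPt W (e : W -> ambient A) x : satA (aPt x) e <-> exists p, e x = pt p.
Proof.
split=> [/sat_fEx[f _ /sat_fEx[y _ /sat_aApp[s [p [_ _ xE _]]]]]|[p xE]]; first by exists p.
have U1 : U id by case: HU.
apply/sat_fEx; exists (fn id) => //; apply/sat_fEx; exists (pt p) => //.
by apply/sat_aApp; exists id, p.
Qed.

Lemma sat_aSwap W (e : W -> ambient A) r x y :
  satA (aSwap r x y) e <->
  exists p q, [/\ p <> q, e x = pt p, e y = pt q & e r = fn (swap p q)].
Proof.
split=> [/sat_fAnd[/sat_aApp[s [p [Us rE xE yE]]]]|[p [q [pq xE yE rE]]]].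
  move=> /sat_fAnd[/sat_aApp[s' [q [_]]]]; rewrite rE xE yE => /fn_inj <- [qE] [pE].
  move=> /sat_fAnd[/sat_fNot + /sat_fAll H]; rewrite sat_fEq xE yE => N.
  exists p, (s p); split=> //; first by move=> E; apply: N; congr pt.
  congr fn; apply/funext => z.
  case: (pselect (z = p)) => [->|zp]; first by rewrite swapL.
  case: (pselect (z = s p)) => [->|zq]; first by rewrite swapR {1}qE -pE.
  have /sat_fImp Hz := H (pt z) I; rewrite swapD //.
  have /sat_fOr[/sat_fEq|/sat_fOr[/sat_fEq|]] : satA
      (fOr (fEq _ None (Some x)) (fOr (fEq _ None (Some y)) (aApp (Some r) None None)))
      (assign e (pt z)) by apply: Hz; apply/sat_aPt; exists z.
  - by rewrite /= xE => -[].
  - by rewrite /= yE => -[].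
  by move=> /sat_aApp[s'' [z' [_ /=]]]; rewrite rE => /fn_inj <- [<-] [<-].
have Us : U (swap p q) by exact: monoid_swap.
apply/sat_fAnd; split; first by apply/sat_aApp; exists (swap p q), p; rewrite swapL.
apply/sat_fAnd; split; first by apply/sat_aApp; exists (swap p q), q; rewrite swapR.
apply/sat_fAnd; split.
  by apply/sat_fNot => /sat_fEq; rewrite xE yE => -[].
apply/sat_fAll => b _; apply/sat_fImp => /sat_aPt[z /= ->].
apply/sat_fOr; rewrite sat_fOr !sat_fEq /= xE yE.
case: (pselect (z = p)) => [->|zp]; first by left.
case: (pselect (z = q)) => [->|zq]; first by right; left.
by right; right; apply/sat_aApp; exists (swap p q), z; rewrite swapD.
Qed.

Lemma sat_aCode W (e : W -> ambient A) s t x : Act_univ C (e x) ->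
  satA (aCode s t x) e <-> code C (pair2 (e s) (e t)) (e x).
Proof.
move=> xA; split.
  move=> /sat_fOr[/sat_fAnd[/sat_fEq st /sat_fAnd[/sat_fEq xs /sat_fNot xN]]|].
    case E: (e x) => [f|p]; last by case: xN; apply/sat_aPt; exists p.
    by move: xA; rewrite E => Cf; split=> //; rewrite /pair2 /= -st -xs E.
  move=> /sat_fEx[b _ /sat_fEx[c _ /sat_fAnd[/sat_aSwap[p [q [pq /= xE bE sE]]]]]].
  move=> /sat_fAnd[/sat_aSwap[p' [q' [pq' /=]]]]; rewrite xE => -[?] cE tE; subst p'.
  move=> /sat_fNot /sat_fEq /=; rewrite bE cE => qq'.
  by exists q, q'; split=> //; split=> // E; apply: qq'; rewrite E.
case xE: (e x) => [f|p].
  move=> [Cf [sE tE]]; apply/sat_fOr; left.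
  apply/sat_fAnd; split; first exact: etrans sE (esym tE).
  apply/sat_fAnd; split; first exact: etrans xE (esym sE).
  by apply/sat_fNot => /sat_aPt[p]; rewrite xE.
move=> [y [z [[py pz yz] [sE tE]]]]; apply/sat_fOr; right.
apply/sat_fEx; exists (pt y) => //; apply/sat_fEx; exists (pt z) => //.
apply/sat_fAnd; split; first by apply/sat_aSwap; exists p, y.
apply/sat_fAnd; split; first by apply/sat_aSwap; exists p, z.
by apply/sat_fNot => /sat_fEq /= -[].
Qed.

End ActSatisfaction.

(** * Assembling the interpretation of Act(C) in Alg(C) *)

Definition phi_App (P : L_Act) : formula L_Alg ('I_(arity P) * 'I_2) :=
  match P return formula L_Alg ('I_(@arity L_Act P) * 'I_2) with
  | App n => tr (mApp n)
  end.

(** The interpretation map sends a code to the element it codes; application and equality are the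
    translations by [tr] of their definitions in Mid(C). *)
Lemma Act_interpreted_in_Alg (A : Type) (C : clone A) : K_FTcln C ->
  FS_interprets (fCode ord0 ord_max) phi_App (tr (fEq L_Mid ord0 ord_max))
    (fAnd (fEq L_Alg (Some ord0) (Some ord_max)) (fEq L_Alg None (Some ord0)))
    (aCode (Some ord0) (Some ord_max) None) (Alg C) (Act C).
Proof.
move=> KC.
have pairE (c : 'I_2 -> ambient A) : pair2 (c ord0) (c ord_max) = c.
  by apply/funext; exact: ord2P.
have tauP a b : extension (Act C) (aCode (Some ord0) (Some ord_max) None) (assign a b) <->
    code C a b.
  split=> [[H] /(sat_aCode KC _ _ (H None)) /=|cab]; first by rewrite pairE.
  have aA := code_univ_Alg KC cab.
  have bA := code_univ cab.
  split=> [[i|] //=|]; first by move: (aA i); rewrite /Alg_univ /Act_univ /=; case: (a i).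
  by apply/(@sat_aCode _ _ KC _ (assign a b) (Some ord0) (Some ord_max) None bA); rewrite /= pairE.
have UP a : extension (Alg C) (fCode ord0 ord_max) a <-> exists b, code C a b.
  split=> [[aA /(sat_fCode KC _ (aA ord0))]|[b cab]]; first by rewrite pairE.
  have aA := code_univ_Alg KC cab; split=> //.
  by apply/(sat_fCode KC _ (aA ord0)); exists b; rewrite pairE.
split.
- split=> [a b /tauP cab|a /UP[b cab]|b bA].
  + by split; [apply/UP; exists b|exact: code_univ cab].
  + by exists b; split=> [|b' /tauP cab']; [exact/tauP|exact: (code_fun cab cab')].
  + by have [a cab] := code_onto KC bA; exists a; apply/tauP.
- move=> [n] a b _ ab; rewrite /phi_App (@sat_tr _ _ KC _ _ a b).
    by rewrite (sat_mApp KC).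
  by move=> j; apply/tauP.
- move=> a b _ ab; rewrite (@sat_tr _ _ KC _ _ a b) //.
  by move=> j; apply/tauP.
(* The universe of Alg(C) contains operations but no points, so the map restricted to values there
   consists of the triples (f, f, f). *)
apply/seteqP; split=> e.
  move=> [eA /sat_fAnd[/sat_fEq e01 /sat_fEq eN]].
  have -> : e = assign (fun i => e (Some i)) (e None) by apply/funext; case.
  split; last exact: eA.
  apply/tauP; move: (eA None); case E: (e None) => [f|//] Cf; split=> //.
  by rewrite -e01 -eN E.
have eE : e = assign (fun i => e (Some i)) (e None) by apply/funext; case.
rewrite {1}eE => -[/tauP H eN].
have cA := code_univ_Alg KC H.
split; first by case=> [i|//]; exact: cA.
move: H eN; case E: (e None) => [f|//] [_ [e0 e1]] _.
apply/sat_fAnd; split; first exact: etrans e0 (esym e1).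
exact: etrans E (esym e0).
Qed.

Theorem theoremC : FS_interpretable Act_FTcln Alg_FTcln R_FTcln.
Proof.
split=> [U M M' [A C KC]|].
  by split=> // -[f|].
exists 2, (fCode ord0 ord_max), phi_App, (tr (fEq L_Mid ord0 ord_max)).
exists (fAnd (fEq L_Alg (Some ord0) (Some ord_max)) (fEq L_Alg None (Some ord0))).
exists (aCode (Some ord0) (Some ord_max) None); split=> // U M M' [A C KC].
exact: Act_interpreted_in_Alg.
Qed.
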